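(* Let $T>0$, let $(a_{j,k})_{j,k\ge0}$ be a summable bi-sequence of non-negative coefficients, and let $Z$ and, for positive integers $J,K$, its truncation $\widehat Z$ be the random fields on $\mathbb{S}^2\times[0,T]$ built from $(a_{j,k})$ as described in the context. Let $\nu_1,\nu_2\ge2$. Suppose that there exist positive constants $C_1,C_2,C_3$ and positive integers $j_0,k_0$ such that $$a_{j,0}\le C_1\,j^{-\nu_1},\qquad a_{0,k}\le C_2\,k^{-\nu_2},\qquad a_{j,k}\le C_3\,j^{-\nu_1}k^{-\nu_2},\qquad\text{for all } j\ge j_0 \text{ and } k\ge k_0 .$$ Then the following inequality holds: $$\|Z(\mathbf{x},t)-\widehat Z(\mathbf{x},t)\|^2_{L^2(\Omega\times\mathbb{S}^2\times[0,T])}\le\widetilde C_1\,J^{-(\nu_1-2)}+\widetilde C_2\,J\,K^{-(\nu_2-1)},$$ for some positive constants $\widetilde C_1$ and $\widetilde C_2$ (not depending on $J$ and $K$).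
   Context: $(\Omega,\mathcal{F},\mathbb{P})$ is a complete probability space; $\mathbb{S}^2\subset\mathbb{R}^3$ is the unit sphere with surface area measure, and $[0,T]$ carries Lebesgue measure. A point $\mathbf{x}\in\mathbb{S}^2$ has spherical coordinates $(\beta_1,\beta_2)\in[0,\pi]\times[0,2\pi)$. For $0\le m\le j$, $P_{j,m}(x)=(-1)^m(1-x^2)^{m/2}\frac{d^m}{dx^m}P_j(x)$ with $P_j$ the Legendre polynomial of degree $j$, and $\widetilde P_{j,m}(x)=\sqrt{\frac{2j+1}{4\pi}\frac{(j-m)!}{(j+m)!}}\;P_{j,m}(x)$. Let $A^q_{j,k,m}$ ($k\ge0$) and $B^q_{j,k,m}$ ($k\ge1$), for $j\ge0$, $0\le m\le j$, $q=1,2$, be independent centred real-valued Gaussian random variables with $\mathrm{var}(A^1_{j,k,0})=\mathrm{var}(B^1_{j,k,0})=a_{j,k}$ and $\mathrm{var}(A^q_{j,k,m})=\mathrm{var}(B^q_{j,k,m})=a_{j,k}/2$ for $m\ne0$ (only $q=1$ is used when $m=0$). Put $$R^q_{j,m,K}(t)=A^q_{j,0,m}+\sum_{k=1}^{K}\Big\{A^q_{j,k,m}\cos\big(\tfrac{\pi kt}{2T}\big)+B^q_{j,k,m}\sin\big(\tfrac{\pi kt}{2T}\big)\Big\},\qquad K\in\mathbb{N}\cup\{\infty\}.$$ The field is $$Z(\mathbf{x},t)=\sum_{j=0}^{\infty}\Big(R^1_{j,0,\infty}(t)\widetilde P_{j,0}(\cos\beta_1)+2\sum_{m=1}^j\widetilde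 P_{j,m}(\cos\beta_1)\big\{R^1_{j,m,\infty}(t)\cos(m\beta_2)-R^2_{j,m,\infty}(t)\sin(m\beta_2)\big\}\Big),$$ and its truncation at positive integers $J$ (in $j$) and $K$ (in $k$) is $$\widehat Z(\mathbf{x},t)=\sum_{j=0}^{J}\Big(R^1_{j,0,K}(t)\widetilde P_{j,0}(\cos\beta_1)+2\sum_{m=1}^j\widetilde P_{j,m}(\cos\beta_1)\big\{R^1_{j,m,K}(t)\cos(m\beta_2)-R^2_{j,m,K}(t)\sin(m\beta_2)\big\}\Big).$$
   Formalization: The bound on a_{j,k} is assumed for all j,k ≥ 1 with j ≥ j_0 or k ≥ k_0 (not only both), since otherwise the claim fails, e.g. a_{1,k} = 1/(k log² k) with j_0 = 2; Z is assumed to exist as a jointly measurable mean-square sum of the series. *)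

(* Defs.v *)
From HB Require Import structures.
From mathcomp Require Import all_boot all_order all_algebra.
From mathcomp Require Import all_classical all_reals all_analysis.
From mathcomp Require Import measurable_realfun.

Set Implicit Arguments.
Unset Strict Implicit.
Unset Printing Implicit Defensive.

Import Order.TTheory GRing.Theory Num.Theory.
Import numFieldNormedType.Exports.

Local Open Scope classical_set_scope.
Local Open Scope ring_scope.

Section legendre.
Context {R : realType}.

(* Rodrigues' formula: P_j = (2^j j!)^-1 d^j/dX^j (X^2 - 1)^j. *)
Definition legendre (j : nat) : {poly R} :=
  (2 ^+ j * (j`!)%:R)^-1 *: (('X^2 - 1) ^+ j)^`(j).

Definition assoc_legendre (j m : nat) (x : R) : R :=
  (-1) ^+ m * (1 - x ^+ 2) `^ (m%:R / 2) * ((legendre j)^`(m)).[x].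

Definition normalized_legendre (j m : nat) (x : R) : R :=
  Num.sqrt ((2 * j%:R + 1) / (4 * pi) * (((j - m)`!)%:R / ((j + m)`!)%:R))
  * assoc_legendre j m x.

End legendre.

Section sphere.
Context {R : realType}.

Definition sphere : set (R * R * R) :=
  [set x | x.1.1 ^+ 2 + x.1.2 ^+ 2 + x.2 ^+ 2 = 1].

Definition angle_domain : set (R * R) := `[0, pi] `*` `[0, 2 * pi[.

Definition sphere_param (b : R * R) : R * R * R :=
  (sin b.1 * cos b.2, sin b.1 * sin b.2, cos b.1).

(* (beta_1, beta_2); the second angle is unique except at the two poles, where
   any choice may be made: normalized_legendre j m (+-1) = 0 for m > 0. *)
Definition spherical_coordinates (x : R * R * R) : R * R :=
  get [set b | angle_domain b /\ sphere_param b = x].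

(* Image by sphere_param of the area element sin b_1 db_1 db_2, as a Borel
   measure on R^3 carried by the sphere. *)
Definition surface_measure (E : set (R * R * R)) : \bar R :=
  (\int[lebesgue_measure \x lebesgue_measure]_(b in
     angle_domain `&` sphere_param @^-1` E) (sin b.1)%:E)%E.

Lemma measurable_angle_domain : measurable angle_domain.
Proof. exact: measurableX. Qed.

Lemma angle_domain_sin_ge0 b : angle_domain b -> 0 <= sin b.1.
Proof. by move=> [/= b1 _]; apply: sin_ge0_pi; rewrite in_itv/= in b1. Qed.

Let measurable_sin : measurable_fun setT (@sin R).
Proof.
by apply: continuous_measurable_fun; exact: continuous_sin.
Qed.

Let measurable_cos : measurable_fun setT (@cos R).
Proof.
by apply: continuous_measurable_fun; exact: continuous_cos.
Qed.

Lemma measurable_sin_fst : measurable_fun setT (fun b : R * R => sin b.1).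
Proof. exact: measurableT_comp. Qed.

Lemma measurable_sphere_param : measurable_fun setT sphere_param.
Proof.
apply: measurable_fun_pair; first apply: measurable_fun_pair.
- by apply: measurable_funM; apply: measurableT_comp.
- by apply: measurable_funM; apply: measurableT_comp.
- exact: measurableT_comp.
Qed.

Let measurable_chart E : measurable E ->
  measurable (angle_domain `&` sphere_param @^-1` E).
Proof.
move=> mE; apply: measurableI; first exact: measurable_angle_domain.
by rewrite -[X in measurable X]setTI; exact: measurable_sphere_param.
Qed.

Let surface_measure0 : surface_measure set0 = 0%E.
Proof. by rewrite /surface_measure preimage_set0 setI0 integral_set0. Qed.

Let surface_measure_ge0 E : (0 <= surface_measure E)%E.
Proof.
by apply: integral_ge0 => b [? _]; rewrite lee_fin angle_domain_sin_ge0.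
Qed.

Let surface_measure_sigma_additive : semi_sigma_additive surface_measure.
Proof.
move=> F mF tF mUF; rewrite /surface_measure preimage_bigcup setI_bigcupr.
rewrite ge0_integral_bigcup//.
- apply: is_cvg_ereal_nneg_natsum_cond => n _ _; exact: surface_measure_ge0.
- by move=> n; exact: measurable_chart.
- by apply/measurable_EFinP; apply: measurable_funTS; exact: measurable_sin_fst.
- by move=> b [n _ [? _]]; rewrite lee_fin angle_domain_sin_ge0.
- apply/trivIsetP => i j _ _ ij; move/trivIsetP : tF => /(_ i j I I ij) Fij.
  by rewrite setIACA setIid -preimage_setI Fij preimage_set0 setI0.
Qed.

HB.instance Definition _ := isMeasure.Build _ _ _ surface_measure
  surface_measure0 surface_measure_ge0 surface_measure_sigma_additive.

Let surface_measure_fin : fin_num_fun surface_measure.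
Proof.
move=> E mE; rewrite ge0_fin_numE//; apply: (@le_lt_trans _ _
  (\int[lebesgue_measure \x lebesgue_measure]_(b in angle_domain) 1)%E).
  rewrite /surface_measure; apply: (@le_trans _ _ (\int[lebesgue_measure \x
    lebesgue_measure]_(b in angle_domain `&` sphere_param @^-1` E) 1)%E).
    apply: ge0_le_integral => //.
    - exact: measurable_chart.
    - by move=> b [? _]; rewrite lee_fin angle_domain_sin_ge0.
    - apply/measurable_EFinP; apply: measurable_funTS.
      exact: measurable_sin_fst.
    - by move=> b _; rewrite lee_fin sin_le1.
  apply: ge0_subset_integral => //.
  - exact: measurable_chart.
  - exact: measurable_angle_domain.
rewrite integral_cst/=; last exact: measurable_angle_domain.
rewrite mul1e product_measure1E//= !lebesgue_measure_itv/= !lte_fin.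
by rewrite pi_gt0 mulr_gt0 ?pi_gt0// !EFinN !sube0 -EFinM ltry.
Qed.

HB.instance Definition _ :=
  Measure_isFinite.Build _ _ _ surface_measure surface_measure_fin.

End sphere.

Section random_variables.
Context {R : realType} {d : measure_display} {Omega : measurableType d}.
Variable P : probability Omega R.

(* The degenerate law (variance 0) is the Dirac mass at 0; the value of the
   library's normal_prob at standard deviation 0 is not. *)
Definition centred_gaussian (X : {RV P >-> R}) (v : R) : Prop :=
  forall E : set R, measurable E ->
    distribution P X E =
      if v == 0 then dirac (0 : R) E else normal_prob 0 (Num.sqrt v) E.

Definition mutually_independent (I : choiceType) (D : set I)
    (X : I -> {RV P >-> R}) : Prop :=
  forall (s : seq I) (E : I -> set R), uniq s ->
    (forall i, i \in s -> D i) -> (forall i, measurable (E i)) ->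
    P (\bigcap_(i in [set` s]) (X i @^-1` E i)) =
    (\prod_(i <- s) P (X i @^-1` E i))%E.

Definition mean_square_cvg (X : nat -> Omega -> R) (Y : Omega -> R) : Prop :=
  measurable_fun setT Y /\
  ('N[P]_2[EFin \o (X n \- Y)%R] @[n --> \oo] --> 0)%E.

End random_variables.

Section field.
Context {R : realType} {d : measure_display} {Omega : measurableType d}.
Variable P : probability Omega R.

(* A q j k m and B q j k m stand for A^q_{j,k,m} and B^q_{j,k,m}. *)
Variables A B : nat -> nat -> nat -> nat -> {RV P >-> R}.

(* Superscripts and subscripts in use: 0 <= m <= j and q = 1, 2, with q = 1
   only when m = 0. *)
Definition admissible (q j m : nat) : bool :=
  (m <= j)%N && ((q == 1%N) || ((q == 2%N) && (m != 0%N))).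

(* The A's (true) and the B's (false) gathered in a single family. *)
Definition coefficient (i : bool * (nat * nat * nat * nat)) : {RV P >-> R} :=
  let: (isA, (q, j, k, m)) := i in if isA then A q j k m else B q j k m.

Definition coefficient_index : set (bool * (nat * nat * nat * nat)) :=
  [set i | let: (isA, (q, j, k, m)) := i in
           admissible q j m && (isA || (0 < k)%N)].

Definition gaussian_coefficients (a : nat -> nat -> R) : Prop :=
  mutually_independent coefficient_index coefficient /\
  forall isA q j k m, coefficient_index (isA, (q, j, k, m)) ->
    centred_gaussian (coefficient (isA, (q, j, k, m)))
      (if m == 0%N then a j k else a j k / 2).

Variable T : R.

Definition temporal_process (K q j m : nat) (t : R) (w : Omega) : R :=
  A q j 0 m w +
  \sum_(1 <= k < K.+1) (A q j k m w * cos (pi * k%:R * t / (2 * T)) +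
                        B q j k m w * sin (pi * k%:R * t / (2 * T))).

(* Rt q j m t stands for R^q_{j,m,K}(t), with K finite or infinite. *)
Definition spherical_sum (Rt : nat -> nat -> nat -> R -> Omega -> R)
    (J : nat) (x : R * R * R) (t : R) (w : Omega) : R :=
  let b := spherical_coordinates x in
  \sum_(0 <= j < J.+1)
    (Rt 1%N j 0%N t w * normalized_legendre j 0 (cos b.1) +
     2 * \sum_(1 <= m < j.+1) normalized_legendre j m (cos b.1) *
           (Rt 1%N j m t w * cos (m%:R * b.2) -
            Rt 2%N j m t w * sin (m%:R * b.2))).

Definition truncated_field (J K : nat) : R * R * R -> R -> Omega -> R :=
  spherical_sum (temporal_process K) J.

Definition space_time : set (Omega * (R * R * R) * R) :=
  (setT `*` sphere) `*` `[0, T].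

(* Z is the field on the sphere x [0, T] given by the infinite expansion: both
   the series in k (defining R^q_{j,m,oo}) and the series in j converge in mean
   square, and Z is jointly measurable. *)
Definition is_field (Z : R * R * R -> R -> Omega -> R) : Prop :=
  measurable_fun space_time (fun v => Z v.1.2 v.2 v.1.1) /\
  exists Rt : nat -> nat -> nat -> R -> Omega -> R,
    (forall q j m t, admissible q j m -> t \in `[0, T] ->
       mean_square_cvg P (fun K => temporal_process K q j m t) (Rt q j m t)) /\
    (forall x t, sphere x -> t \in `[0, T] ->
       mean_square_cvg P (fun J => spherical_sum Rt J x t) (Z x t)).

Definition L2_norm (F : R * R * R -> R -> Omega -> R) : \bar R :=
  ('N[(P \x surface_measure) \x lebesgue_measure]_2
     [(fun v => (F v.1.2 v.2 v.1.1)%:E) \_ space_time])%E.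

End field.

(* Main.v *)
(* Write [Z] and its truncations as sums of modes [U j k] of degree [j] and
   temporal frequency [k]. The Gaussian coefficients being orthogonal in L^2, the
   second moment of a finite sum of modes is the sum of the [E (U j k) ^ 2], and
   [E (U j k (x, t)) ^ 2 = (2 j + 1) / (4 pi) * a j k] at every point [(x, t)], by
   [cos ^ 2 + sin ^ 2 = 1] in time and by the addition formula
   [P_j ^ 2 + 2 sum_m (j - m)! / (j + m)! * P_{j,m} ^ 2 = 1] in space. Letting the
   truncation levels go to infinity (Minkowski), [E (Z - Zhat) ^ 2] is at most the
   sum of [(2 j + 1) / (4 pi) * a j k] over the modes missing from [Zhat], namely
   [j > J] or [k > K], which the decay of [a] bounds. The bound is uniform in
   [(x, t)], and integrating it (Tonelli) only costs the finite total measure of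
   the sphere times [0, T]. *)

(* The mean square limits that define [Z] are nested, the one in [k] inside the one in [j], so the
   levels at which a truncation comes close to [Z] are not under control. Finite sums of modes are
   therefore estimated uniformly in these levels, and the limit is taken last.

   The missing modes form two families. For [j > J], a whole row in [k] has weight of order
   [j * j ^ (- nu1)], and for [nu1 > 2] the tail of this series has order [J ^ (- (nu1 - 2))]. For
   [j <= J] and [k > K], each row has order [K ^ (- (nu2 - 1))] uniformly in [j], as
   [j * j ^ (- nu1) <= 1]; the number of rows gives the factor [J]. The first family pairs large [j]
   with every [k], the second large [k] with small [j], hence the use of the joint bound as soon as
   one of the two indices is large.

   The decay gives no information for [J < j0] or [K < k0], and its tail in [j] may diverge at
   [nu1 = 2]. There the bound comes from a number [V] that dominates all finite energies; its
   existence reflects that of [Z]. *)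
Require Import Defs.
From HB Require Import structures.
From mathcomp Require Import all_boot all_order all_algebra.
From mathcomp Require Import all_classical all_reals all_analysis.
From mathcomp Require Import measurable_realfun.
From mathcomp Require Import ring lra zify.

Set Implicit Arguments.
Unset Strict Implicit.
Unset Printing Implicit Defensive.

Import Order.TTheory GRing.Theory Num.Theory.
Import numFieldNormedType.Exports.

Local Open Scope classical_set_scope.
Local Open Scope ring_scope.

(** * The addition formula for associated Legendre functions at a single point *)

Section legendre_addition.
Context {R : realType}.
Implicit Types (j m n : nat) (x : R).

Local Notation w j := (('X^2 - 1 : {poly R}) ^+ j).

(** The power [w j] satisfies [(X^2 - 1) w' = 2 j X w]; one differentiation gives the case [n = 0],
    and each further one the next [n]. *)
Lemma rodrigues_ode j n :
  ('X^2 - 1) * (w j)^`(n.+2) + (2 * n.+1%:R - 2 * j%:R) * 'X * (w j)^`(n.+1)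
  + n.+1%:R * (n%:R - 2 * j%:R) * (w j)^`(n) = 0.
Proof.
have dX2 : ('X^2 - 1 : {poly R})^`() = 2 * 'X.
  by rewrite derivB derivXn derivC subr0 /= expr1 -mulr_natl.
have dnat k : (k%:R : {poly R})^`() = 0 by rewrite -polyC_natr derivC.
elim: n => [|n ih].
  have e1 : ('X^2 - 1) * (w j)^`() = 2 * j%:R * 'X * w j.
    case: j => [|j]; first by rewrite expr0 derivC mulr0 mulr0 !mul0r.
    rewrite deriv_exp dX2 -[_ *+ j.+1]mulr_natl /= [in RHS]exprSr; ring.
  have /= := congr1 (@deriv R) e1.
  rewrite !derivM dX2 derivX !dnat => e2.
  rewrite -[RHS](subrr (2 * 'X * (w j)^`() + ('X^2 - 1) * (w j)^`()^`())) {2}e2.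
  by ring.
have := congr1 (@deriv R) ih.
rewrite !derivD !derivM dX2 !derivB !derivM derivX !dnat -!derivnS derivC.
move=> <-; ring.
Qed.

(** Legendre's equation differentiated [m] times. It is [rodrigues_ode] at [n = j + m], where
    [2 (n + 1) - 2 j] becomes [2 (m + 1)] and [n - 2 j] becomes [m - j]. *)
Lemma legendre_ode j m :
  (1 - 'X^2) * (legendre j)^`(m.+2) - 2 * m.+1%:R * 'X * (legendre j)^`(m.+1)
  + (j%:R - m%:R) * (j + m).+1%:R * (legendre j)^`(m) = 0 :> {poly R}.
Proof.
have dE k : (w j)^`(j)^`(k) = (w j)^`(j + k) by rewrite addnC /derivn iterD.
rewrite /legendre !derivnZ !dE.
set c := (_ ^-1); rewrite !addnS.
rewrite -[X in _ = X](mulr0 (- c%:P)) -(rodrigues_ode j (j + m)) -!mul_polyC.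
by ring.
Qed.

Definition legendre_weight j m : R := ((j - m)`!)%:R / ((j + m)`!)%:R.

(** The ratio of consecutive weights is the zeroth-order coefficient of [legendre_ode]; this match
    is what makes the derivative of [legendre_square_sum] telescope. *)
Lemma legendre_weightS j m : (m < j)%N ->
  legendre_weight j m.+1 * ((j%:R - m%:R) * (j + m).+1%:R) = legendre_weight j m.
Proof.
move=> mj; rewrite /legendre_weight addnS factS.
have -> : (j - m)`! = ((j - m) * (j - m.+1)`!)%N by rewrite -subSS subSn// factS.
rewrite !natrM natrB 1?ltnW//.
have ? : (j + m)`!%:R != 0 :> R by rewrite pnatr_eq0 -lt0n fact_gt0.
have ? : (j + m).+1%:R != 0 :> R by rewrite pnatr_eq0.
by field; apply/andP.
Qed.

(** Squaring turns the half-integer powers of [1 - x ^ 2] in the associated Legendre functions into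
    integer ones, so the sum is a polynomial and formal derivatives apply. *)
Definition legendre_square_sum j : {poly R} := legendre j ^+ 2 +
  2 * \sum_(1 <= m < j.+1)
    (legendre_weight j m)%:P * (1 - 'X^2) ^+ m * (legendre j)^`(m) ^+ 2.

Lemma derivn_legendre0 j : (legendre j)^`(j.+1) = 0 :> {poly R}.
Proof.
rewrite /legendre derivnZ /derivn -iterD -/(derivn _ _) derivn_poly0 ?scaler0//.
apply: (leq_trans (size_poly_exp_leq _ _)).
by rewrite size_XnsubC//= mul2n -addnn addSn.
Qed.

(* By the differential equation, the derivative of the [m]-th term is
   [g m - g m.-1], so the derivative of the sum telescopes to zero. *)
Lemma deriv_legendre_square_sum j : (legendre_square_sum j)^`() = 0.
Proof.
pose g m := (legendre_weight j m)%:P * (1 - 'X^2) ^+ m *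
  (legendre j)^`(m) * (legendre j)^`(m.+1).
have dX2 : (1 - 'X^2 : {poly R})^`() = - (2 * 'X).
  by rewrite derivB derivXn derivC sub0r /= expr1 -mulr_natl.
have dterm m : (m < j)%N ->
    ((legendre_weight j m.+1)%:P * (1 - 'X^2) ^+ m.+1 *
      (legendre j)^`(m.+1) ^+ 2)^`() = g m.+1 - g m.
  move=> mj; rewrite /g -(legendre_weightS mj).
  rewrite !derivM derivC !deriv_exp dX2 -!derivnS -[_ *+ m.+1]mulr_natl [m.+1.-1]/=.
  move: (legendre_weight j m.+1) => c; rewrite !polyCM polyCB !polyC_natr.
  have := legendre_ode j m.
  move: (legendre j)^`(m) (legendre j)^`(m.+1) (legendre j)^`(m.+2) => L0 L1 L2.
  move: c%:P (j%:R - m%:R) (j + m).+1%:R => {}c u v e.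
  have {}e : u * v * L0 = 2 * m.+1%:R * 'X * L1 - (1 - 'X^2) * L2.
    by rewrite -[RHS]addr0 -e; ring.
  have -> : c * (u * v) * (1 - 'X^2) ^+ m * L0 * L1 =
      c * (1 - 'X^2) ^+ m * L1 * (u * v * L0) by ring.
  by rewrite e [_ ^+ m.+1]exprSr; ring.
rewrite /legendre_square_sum derivD derivM -polyC_natr derivC mul0r add0r.
rewrite (big_addn 0 _ 1) subn1 /= raddf_sum.
rewrite (eq_big_nat _ _ (F2 := fun m => g m.+1 - g m)); last first.
  by move=> m /andP[_ mj]; rewrite addn1; exact: dterm.
(* The upper boundary term [g j] contains a derivative of order [j + 1], hence vanishes; the lower
   one, [- 2 * g 0], cancels the derivative of [legendre j ^+ 2]. *)
rewrite telescope_sumr// {1}/g derivn_legendre0 mulr0 sub0r /g.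
rewrite /legendre_weight subn0 addn0 divff ?pnatr_eq0 -?lt0n ?fact_gt0//.
by rewrite expr0 derivn0 derivn1 expr2 derivM polyC_natr; ring.
Qed.

(** With [X^2 - 1 = (X - 1) (X + 1)], the only Leibniz term that survives at 1 has all [j]
    derivatives on [(X - 1) ^ j]. It equals [j! * 2 ^ j], the normalisation in Rodrigues'
    formula. *)
Lemma legendre_at1 j : (legendre j).[1 : R] = 1.
Proof.
have key k (q : {poly R}) :
    ((('X - 1) ^+ k * q)^`(k)).[1] = k`!%:R * q.[1].
  elim: k q => [|k ih] q; first by rewrite expr0 mul1r derivn0 mul1r.
  rewrite derivSn derivM deriv_exp derivB derivX derivC subr0 mul1r /=.
  rewrite -mulr_natl -mulrA.
  have -> : k.+1%:R * (('X - 1) ^+ k * q) + ('X - 1) ^+ k.+1 * q^`() =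
    ('X - 1) ^+ k * (k.+1%:R * q + ('X - 1) * q^`()) by rewrite exprS; ring.
  by rewrite ih factS natrM !hornerE -polyC_natr !hornerE subrr mul0r addr0; ring.
rewrite /legendre hornerZ.
have -> : 'X^2 - 1 = ('X - 1) * ('X + 1) :> {poly R} by ring.
have X1 : (('X + 1 : {poly R}) ^+ j).[1] = 2 ^+ j by rewrite !hornerE.
by rewrite exprMn key X1 [X in _ * X]mulrC mulVf// mulf_neq0 ?expf_neq0//.
Qed.

(** The derivative is zero, so the polynomial is constant; at 1 every term with [m > 0] contains a
    factor [1 - 1 ^ 2]. *)
Lemma legendre_square_sumE j : legendre_square_sum j = 1.
Proof.
have sz : (size (legendre_square_sum j) <= 1)%N.
  (* For a polynomial of size [n + 2], the coefficient of degree [n] of the derivative is [n + 1]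
     times the leading coefficient. *)
  rewrite leqNgt; apply/negP => s1; have := deriv_legendre_square_sum j.
  move/polyP/(_ (size (legendre_square_sum j)).-2); rewrite coef_deriv coef0.
  move: s1; case E: (size _) => [|[|n]]// _ /eqP; rewrite /= mulrn_eq0/=.
  by rewrite -[n.+1]/(n.+2.-1) -E lead_coef_eq0 -size_poly_eq0 E.
rewrite (size1_polyC sz); congr polyC.
have -> : (legendre_square_sum j)`_0 = (legendre_square_sum j).[1].
  by rewrite {2}(size1_polyC sz) hornerC.
rewrite /legendre_square_sum hornerD horner_exp legendre_at1 -polyC_natr.
rewrite hornerM hornerC horner_sum.
rewrite big_nat big1 ?mulr0 ?addr0 ?expr1n// => -[|m] // _.
have X0 : (1 - 'X^2 : {poly R}).[1] = 0 by rewrite !hornerE expr1n subrr.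
by rewrite hornerM hornerM [(_ ^+ m.+1).[_]]horner_exp X0 expr0n mulr0 mul0r.
Qed.

Lemma normalized_legendre_sqr j m x : `|x| <= 1 ->
  normalized_legendre j m x ^+ 2 = (2 * j%:R + 1) / (4 * pi) *
    (legendre_weight j m * (1 - x ^+ 2) ^+ m * ((legendre j)^`(m)).[x] ^+ 2).
Proof.
move=> x1; rewrite /normalized_legendre /assoc_legendre -/(legendre_weight j m).
rewrite exprMn sqr_sqrtr; last first.
  by apply: mulr_ge0; apply: divr_ge0 => //; rewrite ?addr_ge0 ?mulr_ge0 ?pi_ge0.
have x2 : 0 <= 1 - x ^+ 2 by rewrite subr_ge0 -real_normK ?num_real// expr_le1.
rewrite !exprMn sqrr_sign mul1r -[(_ `^ _) ^+ 2]powR_mulrn ?powR_ge0// -powRrM.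
by rewrite divfK// powR_mulrn// !mulrA.
Qed.

Lemma normalized_legendre_addition j x : `|x| <= 1 ->
  normalized_legendre j 0 x ^+ 2 +
    2 * \sum_(1 <= m < j.+1) normalized_legendre j m x ^+ 2 =
  (2 * j%:R + 1) / (4 * pi).
Proof.
move=> x1; rewrite normalized_legendre_sqr//.
under eq_bigr do rewrite normalized_legendre_sqr//.
rewrite -mulr_sumr [2 * (_ * _)]mulrCA -mulrDr; apply: (@etrans _ _ (_ * 1)); last first.
  by rewrite mulr1.
congr (_ * _); rewrite -[RHS](hornerC _ x) -[1%:P](legendre_square_sumE j).
rewrite /legendre_square_sum hornerD horner_exp -polyC_natr hornerM hornerC.
rewrite horner_sum.
rewrite /legendre_weight subn0 addn0 divff ?pnatr_eq0 -?lt0n ?fact_gt0//.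
rewrite expr0 !mul1r; congr (_ + _ * _); apply: eq_bigr => m _.
have X2 : (1 - 'X^2 : {poly R}).[x] = 1 - x ^+ 2 by rewrite !hornerE.
by rewrite !hornerM hornerC !horner_exp X2.
Qed.

End legendre_addition.

(** * Mean and second moment of the centred normal law *)

Section gaussian_moments.
Context {R : realType}.
Local Notation mu := (@lebesgue_measure R).
Implicit Types (m s : R).

(** The Radon-Nikodym derivative of [normal_prob] agrees almost everywhere with [normal_pdf], since
    both have the same integral over every measurable set. *)
Lemma integral_normal_prob m s (f : R -> \bar R) (U : set R) :
  measurable U -> measurable_fun U f ->
  (\int[normal_prob m s]_(x in U) `|f x| < +oo)%E ->
  (\int[normal_prob m s]_(x in U) f x =
   \int[mu]_(x in U) (f x * (normal_pdf m s x)%:E))%E.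
Proof.
move=> mU mf finf; have dom := @normal_prob_dominates R m s.
rewrite -(Radon_Nikodym_change_of_variables dom)//; last exact/integrableP.
have mpdf : measurable_fun U (fun x => (normal_pdf m s x)%:E).
  by apply/measurable_funTS/measurable_EFinP; exact: measurable_normal_pdf.
have iRN : mu.-integrable U
    (Radon_Nikodym (charge_of_finite_measure (normal_prob m s)) mu).
  apply: (integrableS _ _ (@subsetT _ _)) => //=.
  exact: Radon_Nikodym_integrable.
apply: ae_eq_integral => //.
- by apply: emeasurable_funM => //; exact: (measurable_int mu).
- exact: emeasurable_funM.
- apply: ae_eqe_mul2l; rewrite Radon_NikodymE//=; case: cid => /= h [_ ih hE].
  apply: integral_ae_eq => //=; first exact: integrableS ih.
  by move=> E EU mE; rewrite -hE.
Qed.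

Let normal_fun_derive s x : s != 0 ->
  is_derive (x : R) (1 : R) (normal_fun 0 s : R -> R) (- x / s ^+ 2 * normal_fun 0 s x).
Proof.
move=> s0; rewrite /normal_fun; apply: is_derive_eq.
rewrite /GRing.scale/= !subr0; set e := expR _.
by field.
Qed.

Let pdf_derive s x : s != 0 ->
  is_derive (x : R) (1 : R) (normal_pdf 0 s : R -> R) (- x / s ^+ 2 * normal_pdf 0 s x).
Proof.
move=> s0; rewrite normal_pdfE//.
have d := normal_fun_derive x s0.
by apply: is_derive_eq; rewrite /GRing.scale/=; ring.
Qed.


Let continuous_within (f : R -> R) a b : continuous f -> {within `[a, b], continuous f}.
Proof. exact: continuous_subspaceT. Qed.

Let FTC (f F : R -> R) a b : a < b -> continuous f ->
  (forall x, is_derive (x : R) (1 : R) F (f x)) ->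
  (\int[mu]_(x in `[a, b]) (f x)%:E = (F b - F a)%:E)%E.
Proof.
move=> ab cf dF.
have cF : continuous F.
  by move=> x; apply: differentiable_continuous; apply/derivable1_diffP.
rewrite (@continuous_FTC2 _ f F)//.
- exact: continuous_within.
- split.
  + by move=> x _; exact: ex_derive.
  + exact: cvg_at_right_filter (cF a).
  + exact: cvg_at_left_filter (cF b).
- by move=> x _; rewrite derive1E derive_val.
Qed.

Let integrable_itv (nu : probability (measurableTypeR R) R) (f : R -> R) (a b : R) :
  continuous f ->
  nu.-integrable `[a, b] (EFin \o f).
Proof.
move=> cf; apply: measurable_bounded_integrable => //.
- by rewrite -ge0_fin_numE// fin_num_measure.
- by apply/measurable_funTS; exact: continuous_measurable_fun.
- have /compact_bounded[M [_ fM]] := continuous_compact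
    (@continuous_subspaceT _ _ `[a, b]%classic _ cf) (@segment_compact R a b).
  by exists M; split; rewrite ?num_real // => ? ? ? ?; exact: fM.
Qed.

(** Both moments rest on this: an explicit primitive on a symmetric interval, which then grows to
    the whole line. *)
Let truncated_moment s (f F : R -> R) (b : R) : s != 0 -> 0 < b -> continuous f ->
  (forall x, is_derive (x : R) (1 : R) F (f x * normal_pdf 0 s x)) ->
  (\int[normal_prob 0 s]_(x in `[(- b)%R, b]) (f x)%:E = (F b - F (- b))%:E)%E.
Proof.
move=> s0 b0 cf dF.
have mf : measurable_fun setT f by exact: continuous_measurable_fun.
have /integrableP[_ fi] : (normal_prob 0 s).-integrable `[- b, b] (EFin \o f)
  by exact: (integrable_itv _ _ _ cf).
rewrite integral_normal_prob//; last exact/measurable_funTS/measurable_EFinP.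
rewrite -(FTC (f := fun x => f x * normal_pdf 0 s x))//.
  by rewrite (lt_trans _ b0)// oppr_lt0.
by move=> x; apply: cvgM; [exact: cf|exact: continuous_normal_pdf].
Qed.

Let itvN (n : nat) : set R := `[- n%:R, n%:R].

Let itvN_nd : {homo itvN : n m / (n <= m)%N >-> (n <= m)%O}.
Proof.
move=> n m nm; apply/subsetPset => x; rewrite /itvN/= !in_itv/= => /andP[h1 h2].
rewrite (le_trans _ h1) ?lerN2 ?ler_nat//=.
by rewrite (le_trans h2)// ler_nat.
Qed.

Let bigcup_itvN : \bigcup_n itvN n = [set: R].
Proof. by rewrite -(bigcup_itvT true false). Qed.

Let cvg_truncated (nu : probability (measurableTypeR R) R) (f : R -> R) :
  measurable_fun setT f ->
  (forall x, 0 <= f x) ->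
  (\int[nu]_(x in itvN n) (f x)%:E @[n --> \oo] --> \int[nu]_x (f x)%:E)%E.
Proof.
move=> mf f0; rewrite -bigcup_itvN.
apply: ge0_nondecreasing_set_cvg_integral => //.
- by move=> n; exact: measurable_itv.
- by move=> n; apply/measurable_funTS/measurable_EFinP.
- by move=> n x _; rewrite lee_fin.
Qed.

(** The bound [exp (- y) <= 1 / y] at [y = n ^ 2 / (2 s ^ 2)] leaves a quantity of order [1 / n]. *)
Let cvg_tail s : s != 0 ->
  n%:R * normal_pdf 0 s n%:R @[n --> \oo] --> (0 : R).
Proof.
move=> s0; have s2 : 0 < s ^+ 2 by rewrite exprn_even_gt0.
apply: (@squeeze_cvgr _ _ _ _ (fun=> 0)
  (fun n : nat => normal_peak s * (2 * s ^+ 2) * (n%:R)^-1)).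
- near=> n; rewrite mulr_ge0 ?normal_pdf_ge0//= normal_pdfE//.
  have n0 : (0 < n%:R :> R) by rewrite ltr0n; near: n; exact: nbhs_infty_gt.
  rewrite mulrCA -[leRHS]mulrA ler_wpM2l ?normal_peak_ge0//.
  rewrite /normal_fun subr0 mulNr expRN.
  set y := n%:R ^+ 2 / _.
  have y0 : 0 < y by apply: divr_gt0; [exact: exprn_gt0|rewrite pmulrn_lgt0].
  have -> : 2 * s ^+ 2 / n%:R = n%:R * y^-1.
    rewrite /y invf_div -mulr_natl; field; by rewrite gt_eqF//= s0.
  rewrite ler_pM2l// lef_pV2 ?posrE ?expR_gt0//.
  by rewrite (le_trans _ (expR_ge1Dx _))// lerDr.
- exact: cvg_cst.
- rewrite -[X in _ --> X](mulr0 (normal_peak s * (2 * s ^+ 2))).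
  apply: cvgMr; apply/gtr0_cvgV0; last exact: cvgr_idn.
  by near=> n; rewrite ltr0n; near: n; exact: nbhs_infty_gt.
Unshelve. all: by end_near. Qed.

(** Since [- s ^ 2 * x * normal_pdf 0 s x] is a primitive of [(x ^ 2 - s ^ 2) * normal_pdf 0 s x],
    the integral over [[- n, n]] is [s ^ 2] times the mass of that interval minus a boundary term,
    which [cvg_tail] sends to 0. *)
Lemma normal_second_moment s : s != 0 ->
  (\int[normal_prob 0 s]_x (x ^+ 2)%:E = (s ^+ 2)%:E)%E.
Proof.
move=> s0.
have c0 : (\int[normal_prob 0 s]_(x in itvN n) (x ^+ 2)%:E @[n --> \oo] -->
    \int[normal_prob 0 s]_x (x ^+ 2)%:E)%E.
  refine (@cvg_truncated _ (fun x => x ^+ 2) _ _); first exact: measurable_funX.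
  by move=> x; rewrite sqr_ge0.
apply: (cvg_unique _ c0) => //.
have c1 : (normal_prob 0 s (itvN n) @[n --> \oo] --> 1%:E)%E.
  have : (\int[normal_prob 0 s]_(x in itvN n) (cst 1 x)%:E @[n --> \oo] -->
      \int[normal_prob 0 s]_x (cst 1 x)%:E)%E.
    by refine (@cvg_truncated _ (cst 1) _ _) => // x; exact: ler01.
  have e U : measurable U ->
      (\int[normal_prob 0 s]_(x in U) (cst 1 x)%:E = normal_prob 0 s U)%E.
    by move=> mU; have := integral_cst (normal_prob 0 s) mU 1%E; rewrite mul1e.
  rewrite e// probability_setT; apply: cvg_trans; apply: near_eq_cvg; near=> n.
  by rewrite e//; exact: measurable_itv.
have c2 : (((s ^+ 2)%:E * normal_prob 0 s (itvN n) -
    (2 * s ^+ 2 * (n%:R * normal_pdf 0 s n%:R))%:E)%E @[n --> \oo]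
    --> (s ^+ 2)%:E)%E.
  rewrite -[X in _ --> X]sube0 -[X in (X - _)%E]mule1; apply: cvgeB => //.
    exact: cvgeZl.
  apply/cvg_EFin; first by near=> n.
  rewrite -[X in _ --> X](mulr0 (2 * s ^+ 2)); apply: cvgMr; exact: cvg_tail.
apply: cvg_trans c2; apply: near_eq_cvg; near=> n.
have n0 : (0 < n%:R :> R) by rewrite ltr0n; near: n; exact: nbhs_infty_gt.
have cx2 : continuous (fun x : R => x ^+ 2) by move=> x; exact: exprn_continuous.
have cf : continuous (fun x : R => x ^+ 2 - s ^+ 2).
  by move=> x; apply: cvgB; [exact: cx2|exact: cvg_cst].
transitivity (\int[normal_prob 0 s]_(x in itvN n) ((x ^+ 2 - s ^+ 2)%:E +
    (s ^+ 2)%:E))%E; last first.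
  by apply: eq_integral => x _; rewrite -EFinD subrK.
rewrite integralD//=; last 3 first.
- exact: measurable_itv.
- exact: integrable_itv cf.
- by apply: integrable_itv; exact: cst_continuous.
rewrite integral_cst//=; last exact: measurable_itv.
have dF x : is_derive (x : R) (1 : R) (fun x => - s ^+ 2 * (x * normal_pdf 0 s x))
    ((x ^+ 2 - s ^+ 2) * normal_pdf 0 s x).
  have d := pdf_derive x s0.
  by apply: is_derive_eq; rewrite /GRing.scale/=; field.
rewrite (truncated_moment s0 n0 cf dF) addeC; congr (_%:E + _)%E.
by rewrite !normal_pdfE// /normal_fun !subr0 sqrrN; ring.
Unshelve. all: by end_near. Qed.

Lemma integrable_normal_id s : s != 0 ->
  (normal_prob 0 s).-integrable setT (EFin \o (@id R)).
Proof.
move=> s0; apply/integrableP; split; first exact/measurable_EFinP.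
apply: (@le_lt_trans _ _ (\int[normal_prob 0 s]_x (1 + x ^+ 2)%:E)%E).
  apply: ge0_le_integral => //.
  - by apply/measurable_EFinP; exact: measurableT_comp.
  - by apply/measurable_EFinP/measurable_funD => //; exact: measurable_funX.
  - move=> x _; rewrite /= lee_fin; have := sqr_ge0 (`|x| - 1).
    by rewrite -(real_normK (num_real x)); have := normr_ge0 x; nra.
under eq_integral do rewrite EFinD.
rewrite ge0_integralD//=.
- by rewrite normal_second_moment// integral_cst//= probability_setT mule1 -EFinD ltry.
- by move=> x _; rewrite lee_fin sqr_ge0.
- by apply/measurable_EFinP; exact: measurable_funX.
Qed.

(** The primitive [- s ^ 2 * normal_pdf 0 s x] is even, so every symmetric truncation integrates to
    0; dominated convergence with bound [|x|] concludes. *)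
Lemma normal_mean s : s != 0 -> (\int[normal_prob 0 s]_x x%:E = 0)%E.
Proof.
move=> s0; have ci : continuous (@id R) by move=> x; exact: cvg_id.
pose f (n : nat) : R -> \bar R := (EFin \o (@id R)) \_ (itvN n).
have fn n : (\int[normal_prob 0 s]_x f n x = 0)%E.
  rewrite -integral_mkcond; case: n => [|n].
    by apply: integral0_eq => x; rewrite /itvN/= in_itv/= oppr0 -eq_le => /eqP <-.
  have dF x : is_derive (x : R) (1 : R) (fun x => - s ^+ 2 * normal_pdf 0 s x)
      (id x * normal_pdf 0 s x).
    have d := pdf_derive x s0.
    by apply: is_derive_eq; rewrite /GRing.scale/=; field.
  rewrite (truncated_moment s0 (ltr0Sn _ n) ci dF).
  by rewrite !normal_pdfE// /normal_fun !subr0 sqrrN subrr.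
have : (\int[normal_prob 0 s]_x f n x @[n --> \oo] -->
    \int[normal_prob 0 s]_x x%:E)%E.
  refine (@dominated_cvg _ (measurableTypeR R) R (normal_prob 0 s) setT
    measurableT f EFin (fun x => `|x%:E|)%E _ _ _ _ _) => //.
  - move=> n; apply/(measurable_restrictT _ (measurable_itv _)).
    exact/measurable_funTS/measurable_EFinP.
  - move=> x _; apply: cvg_near_cst.
    have : [set: R] x by []. rewrite -bigcup_itvN => -[n _ xn].
    exists n => // m nm; rewrite /f patchE ifT// inE.
    by have /subsetPset := itvN_nd nm; apply.
  - exact: integrable_abse (integrable_normal_id s0).
  - move=> n x _; rewrite /f patchE; case: ifPn => // _.
    by rewrite abse0.
under eq_cvg do rewrite fn.
by move=> h; rewrite -(cvg_unique (@ereal_hausdorff R) h (cvg_cst _)).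
Qed.

End gaussian_moments.

(** * The L^2 norm of real functions *)

Section square_integrable.
Context {d : measure_display} {T : measurableType d} {R : realType}.
Variable mu : {measure set T -> \bar R}.

Lemma Lnorm2E (f : T -> R) :
  'N[mu]_2[EFin \o f]%E = sqrte (\int[mu]_x (f x ^+ 2)%:E)%E.
Proof.
rewrite unlock -poweR12_sqrt; last by apply: integral_ge0 => x _; rewrite lee_fin sqr_ge0.
congr poweR; apply: eq_integral => x _ /=.
by rewrite powR_mulrn// real_normK// num_real.
Qed.

Lemma Lnorm2_sqr (f : T -> R) :
  ('N[mu]_2[EFin \o f] ^+ 2 = \int[mu]_x (f x ^+ 2)%:E)%E.
Proof.
by rewrite Lnorm2E sqr_sqrte// integral_ge0// => x _; rewrite lee_fin sqr_ge0.
Qed.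

Lemma Lnorm2Z (c : R) (f : T -> R) : measurable_fun setT f ->
  ('N[mu]_2[EFin \o (fun x => c * f x)%R] = `|c|%:E * 'N[mu]_2[EFin \o f])%E.
Proof.
move=> mf; rewrite !Lnorm2E.
under eq_integral do rewrite exprMn EFinM.
rewrite ge0_integralZl//.
- by rewrite sqrteM ?lee_fin ?sqr_ge0//= sqrtr_sqr.
- by apply/measurable_EFinP; exact: measurable_funX.
- by move=> x _; rewrite lee_fin sqr_ge0.
- by rewrite lee_fin sqr_ge0.
Qed.

Lemma Lfun2I (f : T -> R) : measurable_fun setT f ->
  (\int[mu]_x (f x ^+ 2)%:E < +oo)%E -> f \in Lfun mu 2%:E.
Proof.
move=> mf f2; apply/andP; split; rewrite inE//= /finite_norm Lnorm2E.
by rewrite -poweR12_sqrt ?poweR_lty// integral_ge0// => x _; rewrite lee_fin sqr_ge0.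
Qed.

End square_integrable.

(** * Moments and orthogonality of independent centred Gaussian variables *)

Section gaussian_families.
Context {R : realType} {d : measure_display} {Omega : measurableType d}.
Variable P : probability Omega R.
Implicit Types X Y : {RV P >-> R}.

Let finP : P setT \is a fin_num. Proof. exact: fin_num_measure. Qed.

Lemma second_moment_variance (X : Omega -> R) : X \in Lfun P 2%:E ->
  ('E_P[X] = 0)%E -> (\int[P]_w (X w ^+ 2)%:E = 'V_P[X])%E.
Proof.
move=> X2 X0; rewrite varianceE// X0 expe2 mule0 sube0.
by rewrite unlock; apply: eq_integral.
Qed.

(* [normal_prob] is a measure on [measurableTypeR R], whose measurable sets are
   those of [R] but whose display is not; hence the detour through pushforwards. *)
Lemma measurable_RV X : measurable_fun setT (X : Omega -> measurableTypeR R).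
Proof. exact: (measurable_funPT X). Qed.

Lemma centred_gaussian_integral X v (f : R -> \bar R) : v != 0 ->
  centred_gaussian X v ->
  (\int[pushforward P (X : Omega -> measurableTypeR R)]_x f x =
   \int[normal_prob 0 (Num.sqrt v)]_x f x)%E.
Proof.
move=> v0 Xv; apply: eq_measure_integral; first exact: measurable_RV.
move=> mX E mE _.
by have := Xv E mE; rewrite (negbTE v0).
Qed.

Lemma centred_gaussian_integral0 X (f : R -> \bar R) :
  measurable_fun [set: measurableTypeR R] f -> centred_gaussian X 0 ->
  (\int[pushforward P (X : Omega -> measurableTypeR R)]_x f x)%E = f 0.
Proof.
move=> mf Xv; transitivity (\int[dirac (0%R : measurableTypeR R)]_x f x)%E.
  apply: eq_measure_integral; first exact: measurable_RV.
  by move=> mX E mE _; have := Xv E mE; rewrite eqxx.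
by rewrite integral_dirac ?diracT ?mul1e.
Qed.

Lemma centred_gaussian_second_moment X v : 0 <= v -> centred_gaussian X v ->
  (\int[P]_w (X w ^+ 2)%:E)%E = v%:E.
Proof.
move=> v0 Xv.
have mX2 : measurable_fun setT (fun x : measurableTypeR R => (x ^+ 2)%:E).
  by apply/measurable_EFinP; exact: measurable_funX.
transitivity (\int[pushforward P (X : Omega -> measurableTypeR R)]_x (x ^+ 2)%:E)%E.
  rewrite ge0_integral_pushforward//; first exact: measurable_RV.
  by move=> y _; rewrite lee_fin sqr_ge0.
(* A coefficient [a j k] may vanish, and the law is then the Dirac mass at 0. *)
have [v_eq0|v_neq0] := eqVneq v 0.
  by rewrite v_eq0 in Xv *; rewrite (centred_gaussian_integral0 mX2 Xv) expr0n.
rewrite (centred_gaussian_integral _ v_neq0 Xv) normal_second_moment ?sqr_sqrtr//.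
by rewrite sqrtr_eq0 -ltNge lt_neqAle eq_sym v_neq0.
Qed.

Lemma centred_gaussian_Lfun2 X v : 0 <= v -> centred_gaussian X v ->
  (X : Omega -> R) \in Lfun P 2%:E.
Proof.
move=> v0 Xv; apply: Lfun2I => //.
by rewrite (centred_gaussian_second_moment v0 Xv) ltry.
Qed.

Lemma centred_gaussian_expectation X v : 0 <= v -> centred_gaussian X v ->
  ('E_P[X] = 0)%E.
Proof.
move=> v0 Xv; have X2 := centred_gaussian_Lfun2 v0 Xv.
have /Lfun1_integrable iX := Lfun_subset12 finP X2.
rewrite unlock.
transitivity (\int[pushforward P (X : Omega -> measurableTypeR R)]_x x%:E)%E.
  by rewrite integral_pushforward//; exact: measurable_RV.
have [v_eq0|v_neq0] := eqVneq v 0.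
  by rewrite v_eq0 in Xv *; rewrite (centred_gaussian_integral0 _ Xv).
rewrite (centred_gaussian_integral _ v_neq0 Xv) normal_mean//.
by rewrite sqrtr_eq0 -ltNge lt_neqAle eq_sym v_neq0.
Qed.

Lemma centred_gaussian_variance X v : 0 <= v -> centred_gaussian X v ->
  ('V_P[X] = v%:E)%E.
Proof.
move=> v0 Xv; rewrite -second_moment_variance.
- exact: centred_gaussian_second_moment.
- exact: centred_gaussian_Lfun2 Xv.
- exact: centred_gaussian_expectation Xv.
Qed.

(** The law of [(X, Y)] is the product of the marginal laws, because they agree on rectangles; in
    Fubini's formula for the expectation of [X Y] the inner integral is then a multiple of the mean
    of [Y]. *)
Lemma independent_covariance X Y :
  (forall E F, measurable E -> measurable F ->
    P (X @^-1` E `&` Y @^-1` F) = (P (X @^-1` E) * P (Y @^-1` F))%E) ->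
  (X : Omega -> R) \in Lfun P 2%:E -> (Y : Omega -> R) \in Lfun P 2%:E ->
  ('E_P[Y] = 0)%E -> covariance P X Y = 0%E.
Proof.
move=> indep X2 Y2 Y0.
have X1 := Lfun_subset12 finP X2; have Y1 := Lfun_subset12 finP Y2.
have XY1 := Lfun2_mul_Lfun1 X2 Y2.
rewrite covarianceE// Y0 mule0 sube0.
pose phi w : R * R := (X w, Y w).
have mphi : measurable_fun setT phi by exact: measurable_fun_pair.
pose f (z : R * R) := (z.1 * z.2)%:E.
have mf : measurable_fun setT f.
  by apply/measurable_EFinP; exact: measurable_funM.
have fi : P.-integrable setT (f \o phi) by exact/Lfun1_integrable.
pose PX : probability R R := distribution P X.
pose PY : probability R R := distribution P Y.
have PXY : forall E : set (R * R), measurable E -> (PX \x PY)%E E = pushforward P phi E.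
  by move=> E mE; apply: product_measure_unique => //.
transitivity (\int[pushforward P phi]_z f z)%E.
  by rewrite integral_pushforward// unlock.
transitivity (\int[PX \x PY]_z f z)%E.
  apply: eq_measure_integral => E mE _; apply/esym; exact: PXY.
rewrite -integral12_prod_meas1; last first.
  have /integrableP[_ fi'] := integrable_pushforward mphi mf fi measurableT.
  apply/integrableP; split => //; apply: le_lt_trans fi'.
  rewrite le_eqVlt; apply/orP; left; apply/eqP.
  by apply/esym; apply: eq_measure_integral => E mE _; apply/esym; exact: PXY.
have iY : PY.-integrable setT (EFin : R -> \bar R).
  apply: integrable_pushforward => //; exact/Lfun1_integrable.
apply: integral0_eq => x _; rewrite /fubini_F /f /=.
under eq_integral do rewrite EFinM.
rewrite integralZl//.
rewrite (integral_distribution (f := EFin))//; last exact/Lfun1_integrable.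
by move: Y0; rewrite unlock => ->; rewrite mule0.
Qed.

(** Pythagoras' theorem. Means being zero, second moments are variances, and in an induction over
    duplicate-free lists the new variable has zero covariance with the sum already formed. *)
Lemma orthogonal_sum (I : finType) (D : pred I) (X : I -> Omega -> R) (c : I -> R)
    (v : I -> R) :
  (forall i, D i -> X i \in Lfun P 2%:E) ->
  (forall i, D i -> ('E_P[X i] = 0)%E) ->
  (forall i, D i -> ('V_P[X i] = (v i)%:E)%E) ->
  (forall i j, D i -> D j -> i != j -> covariance P (X i) (X j) = 0%E) ->
  (\int[P]_w ((\sum_(i | D i) c i * X i w) ^+ 2)%:E)%E =
  (\sum_(i | D i) c i ^+ 2 * v i)%:E.
Proof.
move=> X2 X0 Xv Xcov.
pose S (s : seq I) : Omega -> R := fun w => \sum_(i <- s) c i * X i w.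
have X1 i : D i -> X i \in Lfun P 1 by move=> /X2; exact: Lfun_subset12.
have Sc i s : S (i :: s) = (c i \o* X i) \+ S s.
  by apply/funext => w; rewrite /S big_cons /= mulrC.
have LZ i : D i -> c i \o* X i \in Lfun P 2%:E.
  by move=> Di; apply: Lfun_scale; [rewrite ler1n|exact: X2].
have L s : all D s -> S s \in Lfun P 2%:E.
  elim: s => [_|i s ih /= /andP[Di Ds]].
    have -> : S [::] = cst 0 by apply/funext => w; rewrite /S big_nil.
    exact: Lfun_cst.
  by rewrite Sc rpredD ?lee1n// => ?; [exact: LZ|exact: ih].
have E0 s : all D s -> ('E_P[S s] = 0)%E.
  elim: s => [_|i s ih /= /andP[Di Ds]].
    have -> : S [::] = cst 0 by apply/funext => w; rewrite /S big_nil.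
    by rewrite expectation_cst.
  rewrite Sc expectationD ?(Lfun_subset12 finP) ?LZ ?L//.
  by rewrite expectationZl ?(Lfun_subset12 finP) ?X2// X0// mule0 add0e ih.
have C0 i s : D i -> all D s -> i \notin s -> covariance P (X i) (S s) = 0%E.
  move=> Di; elim: s => [_ _|j s ih /= /andP[Dj Ds]].
    have -> : S [::] = cst 0 by apply/funext => w; rewrite /S big_nil.
    by rewrite covariance_cst_r.
  rewrite inE negb_or => /andP[ij iNs].
  rewrite Sc (covarianceDr (X2 _ Di) (LZ _ Dj) (L _ Ds)) ih// adde0.
  rewrite (covarianceZr _ (X1 _ Di) (X1 _ Dj) (Lfun2_mul_Lfun1 (X2 _ Di) (X2 _ Dj))).
  by rewrite Xcov// mule0.
have V s : all D s -> uniq s -> ('V_P[S s] = (\sum_(i <- s) c i ^+ 2 * v i)%R%:E)%E.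
  elim: s => [_ _|i s ih /= /andP[Di Ds] /andP[iNs us]].
    have -> : S [::] = cst 0 by apply/funext => w; rewrite /S big_nil.
    by rewrite variance_cst big_nil.
  rewrite Sc big_cons (varianceD (LZ _ Di) (L _ Ds)) ih// (varianceZ _ (X2 _ Di)) Xv//.
  rewrite (covarianceZl _ (X1 _ Di) (Lfun_subset12 finP (L _ Ds))); last first.
    exact: Lfun2_mul_Lfun1 (X2 _ Di) (L _ Ds).
  rewrite C0//.
  by rewrite !mule0 adde0 -EFinM -EFinD.
pose s := [seq i <- index_enum I | D i].
have Ds : all D s by exact: filter_all.
transitivity (\int[P]_w (S s w ^+ 2)%:E)%E.
  by apply: eq_integral => w _; rewrite /S big_filter.
rewrite (second_moment_variance (L _ Ds) (E0 _ Ds)) V ?big_filter//.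
by rewrite filter_uniq// index_enum_uniq.
Qed.

End gaussian_families.

(** * Tails of the weighted double series of variances *)

Section tails.
Context {R : realType}.
Implicit Types (s : R) (j k J K M N : nat).

(* Bernoulli's inequality for [(n / n.+1) `^ (- s)]. *)
Lemma powR_telescope s n : 0 < s -> (0 < n)%N ->
  s * n.+1%:R `^ (- (s + 1)) <= n%:R `^ (- s) - n.+1%:R `^ (- s).
Proof.
move=> s0 n0; have n0' : 0 < n%:R :> R by rewrite ltr0n.
have m0 : 0 < n.+1%:R :> R by rewrite ltr0n.
have e : n.+1%:R `^ (- (s + 1)) = n.+1%:R `^ (- s) / n.+1%:R :> R.
  by rewrite opprD powRD ?(gt_eqF m0) ?implybT// [_ `^ (- 1)]powRN powRr1// ltW.
rewrite e lerBrDr mulrCA -[X in _ + X]mulr1 -mulrDr.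
(* For a real exponent, Bernoulli's inequality results from [ln (1 + u) <= u] at
   [u = - 1 / (n + 1)], followed by [exp y >= 1 + y]. *)
have lnle : ln n%:R - ln n.+1%:R <= - n.+1%:R^-1 :> R.
  have := @le_ln1Dx R (- n.+1%:R^-1).
  have -> : 1 + - n.+1%:R^-1 = n%:R / n.+1%:R :> R.
    by rewrite -[n.+1%:R]natr1; field; rewrite natr1 gt_eqF.
  rewrite ln_div ?posrE//; apply.
  by rewrite ltrN2 invf_lt1// ltr1n ltnS.
rewrite /powR !gt_eqF//.
have -> : - s * ln n%:R = - s * ln n.+1%:R + s * (ln n.+1%:R - ln n%:R) :> R by ring.
rewrite expRD ler_wpM2l ?expR_ge0//.
apply: (le_trans _ (expR_ge1Dx _)); rewrite [leLHS]addrC.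
by rewrite lerD2l (ler_wpM2l (ltW s0))// -lerN2 opprB.
Qed.

(** A discrete form of the comparison with the integral of [x ^ (- (s + 1))] from [K] to
    infinity. *)
Lemma sum_powR_tail s K N : 0 < s -> (0 < K)%N ->
  \sum_(K <= k < N) k.+1%:R `^ (- (s + 1)) <= K%:R `^ (- s) / s.
Proof.
move=> s0 K0; rewrite ler_pdivlMr// mulrC mulr_sumr.
have [NK|KN] := leqP N K; first by rewrite big_geq// powR_ge0.
apply: (@le_trans _ _ (\sum_(K <= k < N) - (k.+1%:R `^ (- s) - k%:R `^ (- s)))).
  apply: ler_sum_nat => k /andP[Kk _]; rewrite opprB.
  by apply: powR_telescope => //; exact: leq_trans Kk.
rewrite sumrN telescope_sumr 1?ltnW// opprB gerBl; exact: powR_ge0.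
Qed.

Lemma sum_powR_le s N : 0 < s ->
  \sum_(0 <= k < N) k.+1%:R `^ (- (s + 1)) <= 1 + s^-1.
Proof.
move=> s0; case: N => [|N]; first by rewrite big_geq// addr_ge0// invr_ge0 ltW.
rewrite big_ltn// powR1 lerD2l (le_trans (sum_powR_tail _ _ _))//.
by rewrite powR1 mul1r.
Qed.

Lemma sum_indic_tail (g : nat -> R) J N : (J <= N)%N ->
  \sum_(0 <= j < N.+1) (J < j)%N%:R * g j = \sum_(J <= j < N) g j.+1.
Proof.
move=> JN; rewrite (big_cat_nat (n := J.+1))//= big_nat big1 ?add0r; last first.
  by move=> j /andP[_]; rewrite ltnS leqNgt => /negbTE ->; rewrite mul0r.
rewrite big_add1 /= big_nat [RHS]big_nat; apply: eq_bigr => j /andP[Jj _].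
by rewrite ltnS Jj mul1r.
Qed.

Lemma sum_nat_ltn J N : (\sum_(0 <= j < N) (j < J) <= J)%N.
Proof.
(* The induction on [N] needs the sharper bound: once [N] has reached [J], the new terms are 0. *)
suff : (\sum_(0 <= j < N) (j < J) <= minn J N)%N.
  by move=> h; apply: (leq_trans h); exact: geq_minl.
elim: N => [|N ih]; first by rewrite big_geq.
rewrite big_nat_recr//=; move: ih; set s := (\sum_(0 <= j < N) _)%N; lia.
Qed.

Definition mode_weight j : R := (2 * j%:R + 1) / (4 * pi).

Lemma mode_weight_ge0 j : 0 <= mode_weight j.
Proof. by rewrite divr_ge0 ?addr_ge0 ?mulr_ge0 ?pi_ge0. Qed.

Lemma mode_weight0 : mode_weight 0 <= 1.
Proof.
rewrite /mode_weight mulr0 add0r div1r invf_le1; have := @pi_ge2 R; lra.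
Qed.

Lemma mode_weightS j : mode_weight j.+1 <= j.+1%:R.
Proof.
have p2 := @pi_ge2 R; rewrite ler_pdivrMr; last by lra.
have : 0 <= j%:R :> R by []. rewrite -natr1; nra.
Qed.

(** Below the threshold [m] a constant bound [V] is turned into a power bound through
    [(m / n) ^ s >= 1]. *)
Lemma powR_constant_le (V s : R) n m : 0 <= V -> 0 <= s -> (0 < n)%N -> (n <= m)%N ->
  V <= V * m%:R `^ s * n%:R `^ (- s).
Proof.
move=> V0 s0 n0 nm; rewrite -mulrA -[leLHS]mulr1 ler_wpM2l// powRN.
rewrite ler_pdivlMr ?powR_gt0 ?ltr0n// mul1r ge0_ler_powR// ?nnegrE//.
by rewrite ler_nat.
Qed.

Variables (a : nat -> nat -> R) (nu1 nu2 C1 C2 C3 : R) (j0 k0 : nat).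
Hypotheses (a_ge0 : forall j k, 0 <= a j k) (nu1_ge2 : 2 <= nu1) (nu2_ge2 : 2 <= nu2).
Hypotheses (C1_gt0 : 0 < C1) (C2_gt0 : 0 < C2) (C3_gt0 : 0 < C3).
Hypothesis k0_gt0 : (0 < k0)%N.
Hypothesis aj0 : forall j, (j0 <= j)%N -> a j 0%N <= C1 * j%:R `^ (- nu1).
Hypothesis a0k : forall k, (k0 <= k)%N -> a 0%N k <= C2 * k%:R `^ (- nu2).
Hypothesis ajk : forall j k, (0 < j)%N -> (0 < k)%N -> (j0 <= j)%N || (k0 <= k)%N ->
  a j k <= C3 * j%:R `^ (- nu1) * k%:R `^ (- nu2).
Variable V : R.
Hypothesis V_ub : forall N M,
  \sum_(0 <= j < N.+1) \sum_(0 <= k < M.+1) mode_weight j * a j k <= V.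

Let nu2E : - nu2 = - (nu2 - 1 + 1). Proof. by rewrite subrK. Qed.

Let nu2_gt1 : 0 < nu2 - 1.
Proof. by rewrite subr_gt0 (lt_le_trans _ nu2_ge2)// ltr1n. Qed.

Let nu1_sub : 0 <= nu1 - 2. Proof. by rewrite subr_ge0. Qed.

Let f_ge0 j k : 0 <= mode_weight j * a j k.
Proof. by rewrite mulr_ge0 ?mode_weight_ge0. Qed.

Let V_ge0 : 0 <= V.
Proof.
apply: le_trans (V_ub 0 0); apply: sumr_ge0 => j _; exact: sumr_ge0.
Qed.

Lemma sum_indic_le (Q : nat -> nat -> bool) N M :
  \sum_(0 <= j < N.+1) \sum_(0 <= k < M.+1) (Q j k)%:R * (mode_weight j * a j k)
  <= V.
Proof.
apply: le_trans (V_ub N M); apply: ler_sum => j _; apply: ler_sum => k _.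
by case: (Q j k); rewrite ?mul1r// mul0r.
Qed.

(** The constant of a full row: [C1] accounts for [k = 0], the rest for [k > 0] by [sum_powR_le]. *)
Let D := C1 + C3 * (1 + (nu2 - 1)^-1).

Let row_le j M : (j0 <= j)%N -> (0 < j)%N ->
  \sum_(0 <= k < M.+1) a j k <= D * j%:R `^ (- nu1).
Proof.
move=> jj j1; rewrite big_nat_recl//= /D mulrDl lerD ?aj0//.
apply: (@le_trans _ _ (\sum_(0 <= k < M)
    C3 * j%:R `^ (- nu1) * k.+1%:R `^ (- (nu2 - 1 + 1)))).
  by apply: ler_sum => k _; rewrite -nu2E ajk// jj.
rewrite -mulr_sumr [leRHS]mulrAC ler_wpM2l ?mulr_ge0 ?powR_ge0 ?(ltW C3_gt0)//.
exact: sum_powR_le.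
Qed.

(** In this constant and the next, the first term covers levels below the threshold, the second
    comes from [sum_powR_tail] above it, and the final 1 secures strict positivity. *)
Definition degree_constant := V * j0%:R `^ (nu1 - 2) + D / (nu1 - 2) + 1.
Definition frequency_constant := V * k0%:R `^ (nu2 - 1) + (C2 + C3) / (nu2 - 1) + 1.

Let D_ge0 : 0 <= D.
Proof.
have n0 : 0 <= (nu2 - 1)^-1 by rewrite invr_ge0 ltW.
by rewrite addr_ge0 ?(ltW C1_gt0)// mulr_ge0 ?(ltW C3_gt0)// addr_ge0.
Qed.

Lemma degree_constant_gt0 : 0 < degree_constant.
Proof.
by rewrite ltr_wpDl// addr_ge0 ?mulr_ge0 ?powR_ge0// invr_ge0.
Qed.

Lemma frequency_constant_gt0 : 0 < frequency_constant.
Proof.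
rewrite ltr_wpDl// addr_ge0 ?mulr_ge0 ?powR_ge0 ?invr_ge0 ?(ltW nu2_gt1)//.
by rewrite addr_ge0// ltW.
Qed.

(* For [nu1 = 2] the bound is just [V], since then [(nu1 - 2)^-1 = 0]. *)
Lemma degree_tail J N M : (0 < J)%N -> (J <= N)%N ->
  \sum_(0 <= j < N.+1) \sum_(0 <= k < M.+1) (J < j)%N%:R * (mode_weight j * a j k)
  <= degree_constant * J%:R `^ (- (nu1 - 2)).
Proof.
move=> J0 JN.
have p0 : 0 <= J%:R `^ (- (nu1 - 2)) by exact: powR_ge0.
have q0 : 0 <= D / (nu1 - 2) by rewrite divr_ge0.
rewrite /degree_constant mulrDl mul1r (mulrDl (V * _)).
have [/orP hJ|] := boolP ((nu1 == 2) || (J < j0)%N).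
  rewrite -addrA; apply: ler_wpDr; first exact: addr_ge0 (mulr_ge0 q0 p0) p0.
  apply: (le_trans (sum_indic_le (fun j _ => (J < j)%N) N M)).
  case: hJ => [/eqP ->|jJ].
    by rewrite subrr oppr0 !powRr0 !mulr1.
  by apply: powR_constant_le => //; exact: ltnW.
rewrite negb_or -leqNgt => /andP[nu12 jJ].
have s0 : 0 < nu1 - 2 by rewrite subr_gt0 lt_neqAle eq_sym nu12.
apply: (@le_trans _ _ (D / (nu1 - 2) * J%:R `^ (- (nu1 - 2)))); last first.
  by rewrite -addrA addrCA; apply: ler_wpDr => //; rewrite addr_ge0 ?mulr_ge0 ?powR_ge0.
under eq_bigr do rewrite -mulr_sumr -mulr_sumr.
rewrite sum_indic_tail// mulrAC -mulrA.
apply: (le_trans _ (ler_wpM2l D_ge0 (sum_powR_tail N s0 J0))).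
rewrite mulr_sumr; apply: ler_sum_nat => j /andP[Jj _].
(* The weight [j + 1] raises the exponent to [1 - nu1 = - ((nu1 - 2) + 1)], the form summed by
   [sum_powR_tail] with [s = nu1 - 2]. *)
apply: (@le_trans _ _ (j.+1%:R * (D * j.+1%:R `^ (- nu1)))).
  apply: ler_pM => //; [exact: mode_weight_ge0|exact: sumr_ge0|exact: mode_weightS|].
  by apply: row_le => //; rewrite (leq_trans jJ)// (leq_trans Jj).
rewrite mulrCA ler_wpM2l// -{1}[j.+1%:R]powRr1// -powRD ?pnatr_eq0 ?implybT//.
by rewrite le_eqVlt; apply/orP; left; apply/eqP; congr powR; ring.
Qed.

(** For [k0 <= K], the degree 0 costs [C2 * t] and each of the degrees 1 to [J] at most [C3 * t],
    with [t] the tail in [k]; as [J >= 1], the former is also absorbed by the factor [J]. *)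
Lemma frequency_tail J K N M : (0 < J)%N -> (0 < K)%N -> (J <= N)%N -> (K <= M)%N ->
  \sum_(0 <= j < N.+1) \sum_(0 <= k < M.+1)
    ((j <= J) && (K < k))%N%:R * (mode_weight j * a j k)
  <= frequency_constant * J%:R * K%:R `^ (- (nu2 - 1)).
Proof.
move=> J0 K0 JN KM.
have p0 : 0 <= K%:R `^ (- (nu2 - 1)) by exact: powR_ge0.
have J1 : 1 <= J%:R :> R by rewrite ler1n.
have q0 : 0 <= (C2 + C3) / (nu2 - 1).
  exact: divr_ge0 (addr_ge0 (ltW C2_gt0) (ltW C3_gt0)) (ltW nu2_gt1).
rewrite /frequency_constant mulrAC.
apply: (@le_trans _ _ ((V * k0%:R `^ (nu2 - 1) + (C2 + C3) / (nu2 - 1)) *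
    K%:R `^ (- (nu2 - 1)) * J%:R)); last first.
  by rewrite ler_wpM2r// ler_wpM2r// lerDl.
have [hK|kK] := ltnP K k0.
  apply: (le_trans (sum_indic_le (fun j k => (j <= J) && (K < k))%N N M)).
  apply: (le_trans _ (ler_peMr _ J1)); last first.
    exact: mulr_ge0 (addr_ge0 (mulr_ge0 V_ge0 (powR_ge0 _ _)) q0) p0.
  apply: (@le_trans _ _ (V * k0%:R `^ (nu2 - 1) * K%:R `^ (- (nu2 - 1)))).
    exact: powR_constant_le V_ge0 (ltW nu2_gt1) K0 (ltnW hK).
  by rewrite ler_wpM2r// lerDl.
apply: (@le_trans _ _ ((C2 + C3) / (nu2 - 1) * K%:R `^ (- (nu2 - 1)) * J%:R)); last first.
  by rewrite ler_wpM2r// ler_wpM2r// lerDr; exact: mulr_ge0 V_ge0 (powR_ge0 _ _).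
set t := K%:R `^ (- (nu2 - 1)) / (nu2 - 1).
have t0 : 0 <= t by exact: divr_ge0 p0 (ltW nu2_gt1).
have -> : (C2 + C3) / (nu2 - 1) * K%:R `^ (- (nu2 - 1)) * J%:R = (C2 + C3) * t * J%:R.
  by rewrite /t; ring.
have column j B C : 0 <= B -> (forall k, (k0 <= k)%N -> a j k <= B * k%:R `^ (- nu2)) ->
    mode_weight j * B <= C ->
    \sum_(0 <= k < M.+1) (K < k)%N%:R * (mode_weight j * a j k) <= C * t.
  move=> B0 hB hC; rewrite sum_indic_tail//.
  apply: (le_trans _ (ler_wpM2r t0 hC)).
  apply: (le_trans _ (ler_wpM2l _ (sum_powR_tail M nu2_gt1 K0))); last first.
    by rewrite mulr_ge0 ?mode_weight_ge0.
  rewrite mulr_sumr; apply: ler_sum_nat => k /andP[Kk _].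
  rewrite -[leRHS]mulrA ler_wpM2l ?mode_weight_ge0// -nu2E hB//.
  by rewrite (leq_trans kK)// (leq_trans Kk).
rewrite big_nat_recl//= mulrDl mulrDl lerD//.
  apply: (@le_trans _ _ (C2 * t)); last exact: ler_peMr (mulr_ge0 (ltW C2_gt0) t0) J1.
  apply: (column _ C2) => //; first exact: ltW.
  exact: ler_piMl (ltW C2_gt0) mode_weight0.
apply: (@le_trans _ _ (\sum_(0 <= j < N) (j < J)%N%:R * (C3 * t))); last first.
  rewrite -mulr_suml [leRHS]mulrC (ler_wpM2r (mulr_ge0 (ltW C3_gt0) t0))//.
  by rewrite -natr_sum ler_nat sum_nat_ltn.
apply: ler_sum => j _; have [jJ|jJ] := ltnP j J; last first.
  by rewrite big1 ?mul0r// => k _; rewrite /= mul0r.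
rewrite mul1r /=; apply: (column _ (C3 * j.+1%:R `^ (- nu1))).
- by rewrite mulr_ge0 ?powR_ge0 ?(ltW C3_gt0).
- by move=> k kk; rewrite ajk ?kk ?orbT// (leq_trans k0_gt0).
- rewrite mulrCA -[leRHS]mulr1 ler_wpM2l ?(ltW C3_gt0)//.
  apply: (@le_trans _ _ (j.+1%:R * j.+1%:R `^ (- 1))).
    apply: ler_pM; rewrite ?mode_weight_ge0 ?mode_weightS ?powR_ge0//.
    by rewrite ler_powR ?ler1n// lerN2 (le_trans _ nu1_ge2)// ler1n.
  by rewrite powRN powRr1// divff.
Qed.

Lemma truncation_tail J K N M : (0 < J)%N -> (0 < K)%N -> (J <= N)%N -> (K <= M)%N ->
  \sum_(0 <= j < N.+1) \sum_(0 <= k < M.+1)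
    (~~ ((j <= J) && (k <= K)))%N%:R * (mode_weight j * a j k)
  <= degree_constant * J%:R `^ (- (nu1 - 2)) +
     frequency_constant * J%:R * K%:R `^ (- (nu2 - 1)).
Proof.
move=> J0 K0 JN KM.
apply: (le_trans _ (lerD (degree_tail M J0 JN) (frequency_tail J0 K0 JN KM))).
rewrite -big_split/=; apply: ler_sum => j _; rewrite -big_split/=.
apply: ler_sum => k _; rewrite -mulrDl ler_wpM2r// -natrD ler_nat.
by rewrite [(J < j)%N]ltnNge [(K < k)%N]ltnNge; case: (j <= J)%N; case: (k <= K)%N.
Qed.

End tails.

(** * Modes and the second moments of their finite sums *)

Section expansion.
Context {R : realType} {d : measure_display} {Omega : measurableType d}.
Variable P : probability Omega R.
Variables (A B : nat -> nat -> nat -> nat -> {RV P >-> R}) (T : R).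
Implicit Types (j k m J K N M : nat) (p b : bool) (x : R * R * R) (t : R).

(* [b] tells the A's from the B's; [p = false, true] stands for [q = 1, 2]. *)
Definition time_basis b k t : R :=
  if k == 0%N then b%:R
  else (if b then cos else sin) (pi * k%:R * t / (2 * T)).

(** The value is 0 for [m = 0], [p = true], just as [time_basis] is 0 for [k = 0], [b = false]:
    indices foreign to the expansion get weight 0, so that [p] and [b] range freely. *)
Definition angle_basis p j m (beta : R * R) : R :=
  (if m == 0%N then (~~ p)%:R
   else 2 * (if p then - sin (m%:R * beta.2) else cos (m%:R * beta.2))) *
  normalized_legendre j m (cos beta.1).

Definition mode j k x t (w : Omega) : R :=
  \sum_(0 <= m < j.+1) \sum_p \sum_b
    angle_basis p j m (spherical_coordinates x) * time_basis b k t *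
    coefficient A B (b, (p.+1, j, k, m)) w.

Lemma temporal_processE K q j m t w : temporal_process A B T K q j m t w =
  \sum_(0 <= k < K.+1) \sum_b time_basis b k t * coefficient A B (b, (q, j, k, m)) w.
Proof.
rewrite /temporal_process [RHS]big_ltn// big_bool /time_basis /= mul1r mul0r addr0.
congr (_ + _); apply: eq_big_nat => -[|k] // _.
by rewrite big_bool /= mulrC [B _ _ _ _ _ * _]mulrC.
Qed.

Lemma spherical_sumE Rt J x t (w : Omega) : spherical_sum Rt J x t w =
  \sum_(0 <= j < J.+1) \sum_(0 <= m < j.+1) \sum_p
    angle_basis p j m (spherical_coordinates x) * Rt p.+1 j m t w.
Proof.
apply: eq_bigr => j _; rewrite [RHS]big_ltn// big_bool /angle_basis /=.
rewrite !mul0r add0r mul1r mulrC; congr (_ + _).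
rewrite mulr_sumr; apply: eq_big_nat => -[|m] // _.
by rewrite big_bool /=; ring.
Qed.

Lemma truncated_fieldE J K x t w : truncated_field A B T J K x t w =
  \sum_(0 <= j < J.+1) \sum_(0 <= k < K.+1) mode j k x t w.
Proof.
rewrite /truncated_field spherical_sumE; apply: eq_bigr => j _.
rewrite /mode [RHS]exchange_big/=; apply: eq_bigr => m _.
rewrite [RHS]exchange_big/=; apply: eq_bigr => p _.
rewrite temporal_processE mulr_sumr; apply: eq_bigr => k _.
by rewrite mulr_sumr; apply: eq_bigr => b _; rewrite mulrA.
Qed.

Lemma time_basis_sqr k t : \sum_b time_basis b k t ^+ 2 = 1.
Proof.
rewrite big_bool /time_basis; case: ifP => _ /=; last exact: cos2Dsin2.
by rewrite expr1n expr0n addr0.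
Qed.

(** For [m > 0] the squared factor 2 of the expansion times the halved variance gives [4 / 2], the
    factor 2 of the addition formula. *)
Lemma angle_basis_sqr j beta :
  \sum_(0 <= m < j.+1) \sum_p
    angle_basis p j m beta ^+ 2 * (if m == 0%N then 1 else 2^-1) = mode_weight j.
Proof.
have c1 : `|cos beta.1| <= 1 by rewrite ler_norml cos_geN1 cos_le1.
rewrite -[RHS](normalized_legendre_addition j c1) big_ltn// big_bool.
rewrite /angle_basis /= mul0r expr0n mul0r add0r mul1r mulr1; congr (_ + _).
rewrite mulr_sumr; apply: eq_big_nat => -[|m] // _.
rewrite big_bool /=; have := cos2Dsin2 (m.+1%:R * beta.2).
set c := cos _; set s := sin _; set l := normalized_legendre _ _ _ => cs.
transitivity (2 * l ^+ 2 * (c ^+ 2 + s ^+ 2)); last by rewrite cs mulr1.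
by field.
Qed.

(** Makes the nested sum, whose range of [m] depends on [j], a single sum over the admissible part
    of a fixed finite type, as [orthogonal_sum] requires. *)
Lemma big_mode_index N M (F : nat -> nat -> nat -> bool -> bool -> R) :
  (forall j k m p b, (m <= j)%N -> ~~ (admissible p.+1 j m && (b || (0 < k)%N)) ->
    F j k m p b = 0) ->
  \sum_(0 <= j < N.+1) \sum_(0 <= k < M.+1) \sum_(0 <= m < j.+1) \sum_p \sum_b
    F j k m p b =
  \sum_(i : 'I_N.+1 * 'I_M.+1 * 'I_N.+1 * bool * bool |
     admissible i.1.2.+1 i.1.1.1.1 i.1.1.2 && (i.2 || (0 < i.1.1.1.2)%N))
    F i.1.1.1.1 i.1.1.1.2 i.1.1.2 i.1.2 i.2.
Proof.
move=> F0.
transitivity (\sum_(j < N.+1) \sum_(k < M.+1) \sum_(m < N.+1)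
    \sum_(p : bool) \sum_(b : bool)
      if admissible p.+1 j m && (b || (0 < k)%N) then F j k m p b else 0).
  rewrite big_mkord; apply: eq_bigr => j _; rewrite big_mkord; apply: eq_bigr => k _.
  rewrite big_mkord (big_ord_widen N.+1 (fun m => \sum_p \sum_b F j k m p b))//.
  rewrite big_mkcond; apply: eq_bigr => m _; rewrite ltnS; case: ifP => mj.
    apply: eq_bigr => p _; apply: eq_bigr => b _; case: ifP => // /negbT.
    exact: F0.
  by rewrite big1// => p _; rewrite big1// => b _; rewrite /admissible mj.
by rewrite 4!pair_bigA /= [RHS]big_mkcond.
Qed.

Variable a : nat -> nat -> R.
Hypothesis a_ge0 : forall j k, 0 <= a j k.
Hypothesis gaussian : gaussian_coefficients A B a.

Let variance j k m := if m == 0%N then a j k else a j k / 2.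

Let variance_ge0 j k m : 0 <= variance j k m.
Proof. by rewrite /variance; case: ifP => // _; rewrite divr_ge0. Qed.

Lemma coefficient_covariance i i' : i != i' ->
  coefficient_index i -> coefficient_index i' ->
  covariance P (coefficient A B i) (coefficient A B i') = 0%E.
Proof.
case: gaussian => indep law ii' Di Di'.
case: i i' ii' Di Di' => [b [[[q j] k] m]] [b' [[[q' j'] k'] m']].
move=> ii' Di Di'; have Xi := law b q j k m Di; have Xi' := law b' q' j' k' m' Di'.
move: (b, _) (b', _) ii' Di Di' Xi Xi' => i i' ii' Di Di' Xi Xi'.
apply: independent_covariance.
- move=> E F mE mF; have u : uniq [:: i; i'] by rewrite cons_uniq mem_seq1 ii'.
  have sD l : l \in [:: i; i'] -> coefficient_index l.
    by rewrite !inE => /orP[] /eqP ->.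
  have mEF l : measurable (if l == i then E else F) by case: ifP.
  (* Mutual independence is applied to a two-term sequence. *)
  have := indep [:: i; i'] (fun l => if l == i then E else F) u sD mEF.
  rewrite !big_cons big_nil eqxx [i' == i]eq_sym (negbTE ii') mule1 => <-.
  congr (P _); apply/seteqP; split => [w [Ew Fw] l|w h].
    by rewrite /= !inE => /orP[] /eqP -> /=; rewrite ?eqxx// eq_sym (negbTE ii').
  split; first by have := h i; rewrite /= mem_head eqxx; apply.
  by have := h i'; rewrite /= !inE eqxx orbT [i' == i]eq_sym (negbTE ii') => /(_ isT).
- exact: centred_gaussian_Lfun2 (variance_ge0 _ _ _) Xi.
- exact: centred_gaussian_Lfun2 (variance_ge0 _ _ _) Xi'.
- exact: centred_gaussian_expectation (variance_ge0 _ _ _) Xi'.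
Qed.

(** The selector [Q] lets one identity serve both a full truncation and the difference of two
    truncations. *)
Lemma second_moment_modes (Q : nat -> nat -> bool) N M x t :
  (\int[P]_w ((\sum_(0 <= j < N.+1) \sum_(0 <= k < M.+1)
     (Q j k)%:R * mode j k x t w) ^+ 2)%:E)%E =
  (\sum_(0 <= j < N.+1) \sum_(0 <= k < M.+1)
     (Q j k)%:R * (mode_weight j * a j k))%:E.
Proof.
case: (gaussian) => _ law.
pose beta := spherical_coordinates x.
pose c j k m p b := (Q j k)%:R * angle_basis p j m beta * time_basis b k t.
have c0 j k m p b : (m <= j)%N -> ~~ (admissible p.+1 j m && (b || (0 < k)%N)) ->
    c j k m p b = 0.
  rewrite /admissible => -> /=; rewrite negb_and => /orP[].
    rewrite /c /angle_basis; case: p => //=; rewrite negbK => ->.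
    by rewrite mul0r mulr0 mul0r.
  rewrite negb_or -leqNgt leqn0 => /andP[/negbTE -> /eqP ->].
  by rewrite /c /time_basis mulr0.
pose D (i : 'I_N.+1 * 'I_M.+1 * 'I_N.+1 * bool * bool) :=
  admissible i.1.2.+1 i.1.1.1.1 i.1.1.2 && (i.2 || (0 < i.1.1.1.2)%N).
pose idx (i : 'I_N.+1 * 'I_M.+1 * 'I_N.+1 * bool * bool) :=
  (i.2, (i.1.2.+1, i.1.1.1.1 : nat, i.1.1.1.2 : nat, i.1.1.2 : nat)).
pose v (i : 'I_N.+1 * 'I_M.+1 * 'I_N.+1 * bool * bool) :=
  variance i.1.1.1.1 i.1.1.1.2 i.1.1.2.
have lawD i : D i -> centred_gaussian (coefficient A B (idx i)) (v i).
  by move=> Di; exact: law.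
transitivity (\int[P]_w ((\sum_(i | D i)
    c i.1.1.1.1 i.1.1.1.2 i.1.1.2 i.1.2 i.2 * coefficient A B (idx i) w) ^+ 2)%:E)%E.
  apply: eq_integral => w _; congr (_ ^+ 2)%:E.
  rewrite -(@big_mode_index N M (fun j k m p b =>
    c j k m p b * coefficient A B (b, (p.+1, j, k, m)) w)); last first.
    by move=> j k m p b mj nD; rewrite c0// mul0r.
  apply: eq_bigr => j _; apply: eq_bigr => k _; rewrite /mode mulr_sumr.
  apply: eq_bigr => m _; rewrite mulr_sumr; apply: eq_bigr => p _.
  by rewrite mulr_sumr; apply: eq_bigr => b _; rewrite /c !mulrA.
have L2 i : D i -> (coefficient A B (idx i) : Omega -> R) \in Lfun P 2%:E.
  by move=> /lawD; apply: centred_gaussian_Lfun2; exact: variance_ge0.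
have E0 i : D i -> ('E_P[coefficient A B (idx i)] = 0)%E.
  by move=> /lawD; apply: centred_gaussian_expectation; exact: variance_ge0.
have V i : D i -> ('V_P[coefficient A B (idx i)] = (v i)%:E)%E.
  by move=> /lawD; apply: centred_gaussian_variance; exact: variance_ge0.
have cov i i' : D i -> D i' -> i != i' ->
    covariance P (coefficient A B (idx i)) (coefficient A B (idx i')) = 0%E.
  move=> Di Di' ii'; apply: coefficient_covariance => //.
  apply: contra ii' => /eqP[]; case: i i' {Di Di'} => [[[[j k] m] p] b].
  case=> [[[[j' k'] m'] p'] b'] /= -> pp /val_inj -> /val_inj -> /val_inj ->.
  by rewrite (_ : p = p')//; move: pp; case: p; case: p'.
rewrite (orthogonal_sum _ L2 E0 V cov); congr EFin.
rewrite -(@big_mode_index N M (fun j k m p b => c j k m p b ^+ 2 * variance j k m));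
  last by move=> j k m p b mj nD; rewrite c0// expr0n mul0r.
apply: eq_bigr => j _; apply: eq_bigr => k _.
rewrite -(angle_basis_sqr j beta) mulr_suml mulr_sumr; apply: eq_bigr => m _.
rewrite mulr_suml mulr_sumr; apply: eq_bigr => p _.
rewrite -[RHS]mulr1 -[X in _ = _ * X](time_basis_sqr k t) mulr_sumr.
apply: eq_bigr => b _.
have Q2 : (Q j k)%:R ^+ 2 = (Q j k)%:R :> R.
  by case: (Q j k); rewrite ?expr1n ?expr0n.
by rewrite /c /variance 2!exprMn Q2; case: ifP => _; ring.
Qed.

Lemma measurable_mode j k x t : measurable_fun setT (mode j k x t).
Proof.
apply: measurable_sum => m; apply: measurable_sum => p.
by apply: measurable_sum => b; apply: measurable_funM.
Qed.

End expansion.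

(** * From finite sums of modes to the field *)

Section mean_square_limits.
Context {R : realType} {d : measure_display} {Omega : measurableType d}.
Variable P : probability Omega R.
Implicit Types f g : nat -> Omega -> R.

Local Notation N2 f := ('N[P]_2[EFin \o f])%E.

(** An epsilon form of convergence to 0 in L^2, convenient for finite linear combinations;
    measurability is included for Minkowski's inequality. *)
Definition mean_square_null f := (forall n, measurable_fun setT (f n)) /\
  forall e : R, 0 < e -> exists n0, forall n, (n0 <= n)%N -> (N2 (f n) <= e%:E)%E.

Lemma mean_square_cvg_null f (Y : Omega -> R) :
  (forall n, measurable_fun setT (f n)) -> mean_square_cvg P f Y ->
  mean_square_null (fun n => (f n \- Y)%R).
Proof.
move=> mf [mY fY]; split=> [n|e e0]; first exact: measurable_funB.
have /fine_cvgP[ffin fc] := fY.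
have [n0 _ h0] := ffin; have [n1 _ h1] := cvgr_le _ fc _ e0.
exists (maxn n0 n1) => n; rewrite geq_max => /andP[n0n n1n].
by rewrite -(fineK (h0 _ n0n)) lee_fin; exact: h1.
Qed.

Lemma Lnorm2_add (f g : Omega -> R) : measurable_fun setT f -> measurable_fun setT g ->
  (N2 (fun w => f w + g w)%R <= N2 f + N2 g)%E.
Proof. by move=> mf mg; apply: (@eminkowski _ _ _ P f g 2%:E) => //; rewrite lee1n. Qed.

Lemma Lnorm2_sym (f g : Omega -> R) :
  N2 (fun w => f w - g w)%R = N2 (fun w => g w - f w)%R.
Proof.
by rewrite !Lnorm2E; congr sqrte; apply: eq_integral => w _; rewrite -sqrrN opprB.
Qed.

Lemma mean_square_nullD f g : mean_square_null f -> mean_square_null g ->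
  mean_square_null (fun n w => f n w + g n w).
Proof.
move=> [mf f0] [mg g0]; split=> [n|e e0]; first exact: measurable_funD.
have e2 : 0 < e / 2 by rewrite divr_gt0.
have [n0 h0] := f0 _ e2; have [n1 h1] := g0 _ e2.
exists (maxn n0 n1) => n; rewrite geq_max => /andP[n0n n1n].
apply: (le_trans (Lnorm2_add (mf n) (mg n))).
by rewrite (splitr e) [leRHS]EFinD; apply: leeD; [exact: h0|exact: h1].
Qed.

Lemma mean_square_null0 : mean_square_null (fun _ _ => 0).
Proof.
split=> [n|e e0]; first exact: measurable_cst.
exists 0%N => n _; rewrite Lnorm2E integral0_eq ?sqrte0 ?lee_fin ?ltW//.
by move=> w _; rewrite expr0n.
Qed.

Lemma mean_square_nullZ (c : R) f : mean_square_null f ->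
  mean_square_null (fun n w => c * f n w).
Proof.
move=> [mf f0]; split=> [n|e e0]; first exact: measurable_funM.
have c1 : 0 < `|c| + 1 by rewrite ltr_wpDl.
have [n0 h0] := f0 (e / (`|c| + 1)) (divr_gt0 e0 c1).
exists n0 => n n0n; rewrite Lnorm2Z//.
apply: (le_trans (lee_wpmul2l _ (h0 _ n0n))); first by rewrite lee_fin.
rewrite -EFinM lee_fin mulrCA ler_piMr ?(ltW e0)//.
by rewrite ler_pdivrMr// mul1r lerDl.
Qed.

Lemma mean_square_null_sum (I : eqType) (r : seq I) (F : I -> nat -> Omega -> R) :
  (forall i, i \in r -> mean_square_null (F i)) ->
  mean_square_null (fun n w => \sum_(i <- r) F i n w).
Proof.
elim: r => [_|i r ih hF].
  have -> : (fun (n : nat) w => \sum_(i <- [::]) F i n w) = (fun _ _ => 0).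
    by apply/funext => n; apply/funext => w; rewrite big_nil.
  exact: mean_square_null0.
have -> : (fun n w => \sum_(l <- i :: r) F l n w) =
    (fun n w => F i n w + \sum_(l <- r) F l n w).
  by apply/funext => n; apply/funext => w; rewrite big_cons.
apply: mean_square_nullD; first by apply: hF; rewrite mem_head.
by apply: ih => l lr; apply: hF; rewrite inE lr orbT.
Qed.

Variables (A B : nat -> nat -> nat -> nat -> {RV P >-> R}) (T : R).
Variable a : nat -> nat -> R.
Hypothesis a_ge0 : forall j k, 0 <= a j k.
Hypothesis gaussian : gaussian_coefficients A B a.
Variable Z : R * R * R -> R -> Omega -> R.
Hypothesis field : is_field A B T Z.
Implicit Types (j k m J K N M : nat).

Local Notation S := (truncated_field A B T).

Lemma measurable_temporal_process K q j m t :
  measurable_fun setT (temporal_process A B T K q j m t).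
Proof.
have -> : temporal_process A B T K q j m t = fun w => \sum_(0 <= k < K.+1) \sum_b
    time_basis T b k t * coefficient A B (b, (q, j, k, m)) w.
  by apply/funext => w; rewrite temporal_processE.
by apply: measurable_sum => k; apply: measurable_sum => b; exact: measurable_funM.
Qed.

Lemma measurable_truncated_field J K x t : measurable_fun setT (S J K x t).
Proof.
have -> : S J K x t = fun w => \sum_(0 <= j < J.+1) \sum_(0 <= k < K.+1)
    mode A B T j k x t w by apply/funext => w; rewrite truncated_fieldE.
by apply: measurable_sum => j; apply: measurable_sum => k; exact: measurable_mode.
Qed.

(** The level [M0] depends on [N]: the limit in [k] is taken at a fixed degree, where only finitely
    many processes [Rt] occur. *)
Lemma field_approximation x t (e : R) : sphere x -> t \in `[0, T] -> 0 < e ->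
  exists N0, forall N, (N0 <= N)%N -> exists M0, forall M, (M0 <= M)%N ->
    (N2 (fun w => Z x t w - S N M x t w)%R <= e%:E)%E.
Proof.
case: field => _ [Rt [RtE ZE]] xS tT e0.
have e2 : 0 < e / 2 by rewrite divr_gt0.
have null N : mean_square_null (fun M w => S N M x t w - spherical_sum Rt N x t w).
  have -> : (fun M w => S N M x t w - spherical_sum Rt N x t w) =
    (fun M w => \sum_(0 <= j < N.+1) \sum_(0 <= m < j.+1) \sum_(p : bool)
      angle_basis p j m (spherical_coordinates x) *
        (temporal_process A B T M p.+1 j m t w - Rt p.+1 j m t w)).
    apply/funext => M; apply/funext => w.
    rewrite /truncated_field !spherical_sumE -sumrB; apply: eq_bigr => j _.
    rewrite -sumrB; apply: eq_bigr => m _.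
    by rewrite -sumrB; apply: eq_bigr => p _; rewrite mulrBr.
  apply: mean_square_null_sum => j _; apply: mean_square_null_sum => m.
  rewrite mem_index_iota => /andP[_ mj]; apply: mean_square_null_sum => p _.
  have [adm|nadm] := boolP (admissible p.+1 j m).
    apply: mean_square_nullZ; apply: mean_square_cvg_null; last exact: RtE.
    by move=> n; exact: measurable_temporal_process.
  (* Outside the admissible indices [Rt] is arbitrary, but its factor [angle_basis] is 0. *)
  rewrite [X in mean_square_null X](_ : _ = (fun _ _ => 0)).
    exact: mean_square_null0.
  apply/funext => M; apply/funext => w; move: nadm; rewrite /admissible -ltnS mj /=.
  rewrite /angle_basis; case: p => //=; rewrite negbK => ->.
  by rewrite mul0r mul0r.
(* Individual processes [Rt] are known to be measurable at admissible indices only, so the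
   measurability of the sum is recovered from [null]. *)
have mRt N : measurable_fun setT (spherical_sum Rt N x t).
  have -> : spherical_sum Rt N x t =
      (fun w => S N 0 x t w - (S N 0 x t w - spherical_sum Rt N x t w)).
    by apply/funext => w; rewrite subKr.
  apply: measurable_funB; first exact: measurable_truncated_field.
  exact: (null N).1.
have [mZ _] := ZE x t xS tT.
have [_ Znull] := mean_square_cvg_null mRt (ZE x t xS tT).
have [N0 h0] := Znull _ e2; exists N0 => N N0N.
have [M0 h1] := (null N).2 _ e2; exists M0 => M M0M.
have -> : (fun w => Z x t w - S N M x t w) = (fun w =>
    (Z x t w - spherical_sum Rt N x t w) + (spherical_sum Rt N x t w - S N M x t w)).
  by apply/funext => w; rewrite addrA subrK.
apply: (le_trans (Lnorm2_add _ _)).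
- exact: measurable_funB.
- by apply: measurable_funB => //; exact: measurable_truncated_field.
- rewrite Lnorm2_sym [X in (_ + X)%E]Lnorm2_sym.
  by rewrite (splitr e) [leRHS]EFinD; apply: leeD; [exact: h0|exact: h1].
Qed.

Lemma measurable_field x t : sphere x -> t \in `[0, T] -> measurable_fun setT (Z x t).
Proof. by case: field => _ [Rt [_ ZE]] xS tT; case: (ZE x t xS tT). Qed.

Let energy N M := \sum_(0 <= j < N.+1) \sum_(0 <= k < M.+1) mode_weight j * a j k.

Let term_ge0 j k : 0 <= mode_weight j * a j k.
Proof. by rewrite mulr_ge0 ?mode_weight_ge0. Qed.

Lemma sum_widen (g : nat -> R) J N : (J <= N)%N ->
  \sum_(0 <= j < J.+1) g j = \sum_(0 <= j < N.+1) (j <= J)%N%:R * g j.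
Proof.
move=> JN; rewrite [RHS](big_cat_nat (n := J.+1))//=.
rewrite [X in _ + X]big_nat [X in _ + X]big1 ?addr0.
  by apply: eq_big_nat => j /andP[_]; rewrite ltnS => ->; rewrite mul1r.
by move=> j /andP[Jj _]; rewrite leqNgt Jj mul0r.
Qed.

Let energy_le N M N' M' : (N <= N')%N -> (M <= M')%N -> energy N M <= energy N' M'.
Proof.
move=> NN MM; rewrite /energy (sum_widen _ NN); apply: ler_sum => j _.
case: (j <= N)%N; last by rewrite mul0r sumr_ge0.
rewrite mul1r (sum_widen _ MM); apply: ler_sum => k _.
by case: (k <= M)%N; rewrite ?mul1r// mul0r.
Qed.

Let energy_ge0 N M : 0 <= energy N M.
Proof. by apply: sumr_ge0 => j _; apply: sumr_ge0. Qed.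

Lemma Lnorm2_truncated_field N M x t : N2 (S N M x t) = (Num.sqrt (energy N M))%:E.
Proof.
rewrite Lnorm2E -[RHS]/(sqrte (energy N M)%:E); congr sqrte.
have := second_moment_modes T a_ge0 gaussian (fun _ _ => true) N M x t.
have -> : \sum_(0 <= j < N.+1) \sum_(0 <= k < M.+1) true%:R * (mode_weight j * a j k)
    = energy N M.
  by apply: eq_bigr => j _; apply: eq_bigr => k _; rewrite mul1r.
move=> <-; apply: eq_integral => w _; rewrite truncated_fieldE; congr (_ ^+ 2)%:E.
by apply: eq_bigr => j _; apply: eq_bigr => k _; rewrite mul1r.
Qed.

(* This is where the summability of [(2 j + 1) a j k], which the decay of [a]
   does not give for [nu1 = 2], is drawn from the existence of [Z]. *)
Lemma energy_bounded : 0 < T -> exists V, forall N M,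
  \sum_(0 <= j < N.+1) \sum_(0 <= k < M.+1) mode_weight j * a j k <= V.
Proof.
(* The norm of a truncation is the same at all points, so one suffices: the north pole at time 0. *)
move=> T0; pose x : R * R * R := (0, 0, 1).
have xS : sphere x by rewrite /sphere /= expr0n expr1n !add0r.
have tT : 0 \in `[0, T] by rewrite in_itv/= lexx ltW.
have [N0 h0] := field_approximation xS tT ltr01.
have [M0 h1] := h0 _ (leqnn N0).
(* The two outer 1's bound the distances to [Z] of a larger truncation and of the fixed one at
   [N0, M0]. Any [N, M] may be enlarged first, the energy being monotone. *)
exists ((1 + (1 + Num.sqrt (energy N0 M0))) ^+ 2) => N M; rewrite -/(energy N M).
have [M1 h2] := h0 _ (leq_maxr N N0).
apply: (le_trans (energy_le (leq_maxl N N0) (leq_maxl M M1))).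
set E := energy _ _.
rewrite -[leLHS](sqr_sqrtr (energy_ge0 _ _)) ler_sqr ?nnegrE ?addr_ge0//.
rewrite -lee_fin -(Lnorm2_truncated_field _ _ x 0).
set S1 := S _ _ x 0; set S0 := S N0 M0 x 0.
have -> : S1 = (fun w => (S1 w - Z x 0 w) + ((Z x 0 w - S0 w) + S0 w)).
  by apply/funext => w; rewrite subrK subrK.
have mZ := measurable_field xS tT.
have mS1 : measurable_fun setT S1 by exact: measurable_truncated_field.
have mS0 : measurable_fun setT S0 by exact: measurable_truncated_field.
apply: (le_trans (Lnorm2_add _ _)).
- exact: measurable_funB.
- by apply: measurable_funD => //; exact: measurable_funB.
rewrite [leRHS]EFinD; apply: leeD.
  by rewrite Lnorm2_sym; apply: h2; exact: leq_maxr.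
apply: (le_trans (Lnorm2_add _ _)) => //; first exact: measurable_funB.
rewrite [leRHS]EFinD; apply: leeD; first exact: h1.
by rewrite /S0 Lnorm2_truncated_field.
Qed.

(** Up to any [e > 0] in norm, [Z] is replaced by a truncation at levels beyond [J, K]; what remains
    is the sum of the modes outside the box, bounded by [b] at all such levels. *)
Lemma truncation_error x t J K (b : R) : sphere x -> t \in `[0, T] -> 0 <= b ->
  (forall N M, (J <= N)%N -> (K <= M)%N ->
    \sum_(0 <= j < N.+1) \sum_(0 <= k < M.+1)
      (~~ ((j <= J) && (k <= K)))%N%:R * (mode_weight j * a j k) <= b) ->
  (\int[P]_w ((Z x t w - S J K x t w) ^+ 2)%:E <= b%:E)%E.
Proof.
move=> xS tT b0 hb; rewrite -Lnorm2_sqr -[leRHS](@sqr_sqrte _ b%:E)//.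
rewrite lee_sqr ?sqrte_ge0 ?Lnorm_ge0//; apply/lee_addgt0Pr => e e0.
have [N0 h0] := field_approximation xS tT e0.
have [M0 h1] := h0 _ (leq_maxr J N0).
set N := maxn J N0; set M := maxn K M0.
have JN : (J <= N)%N by exact: leq_maxl.
have KM : (K <= M)%N by exact: leq_maxl.
have -> : (fun w => Z x t w - S J K x t w) =
    (fun w => (Z x t w - S N M x t w) + (S N M x t w - S J K x t w)).
  by apply/funext => w; rewrite addrA subrK.
have mZ := measurable_field xS tT; have mS := measurable_truncated_field.
rewrite addeC; apply: (le_trans (Lnorm2_add _ _)); try exact: measurable_funB.
apply: leeD; first by apply: h1; exact: leq_maxr.
rewrite Lnorm2E lee_sqrt//.
pose Q j k := ~~ ((j <= J) && (k <= K))%N.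
rewrite (_ : (\int[P]_w _)%E = (\sum_(0 <= j < N.+1) \sum_(0 <= k < M.+1)
     (Q j k)%:R * (mode_weight j * a j k))%:E) ?lee_fin ?hb//.
rewrite -(second_moment_modes T a_ge0 gaussian Q N M x t).
apply: eq_integral => w _; congr (_ ^+ 2)%:E.
rewrite !truncated_fieldE (sum_widen _ JN) -sumrB; apply: eq_bigr => j _.
rewrite (sum_widen _ KM) mulr_sumr -sumrB; apply: eq_bigr => k _.
by rewrite /Q; case: (j <= J)%N; case: (k <= K)%N; rewrite /=; ring.
Qed.

End mean_square_limits.

(** * Spherical coordinates and measurability on the sphere *)

Section sphere_measurability.
Context {R : realType}.
Implicit Types (x : R * R * R) (j m : nat) (p : bool).

(** The polar angle is [acos z]. With [s] the distance to the axis, the azimuth is [acos (u / s)] or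
    [2 * pi] minus it, according to the sign of [v], and 0 at the poles. *)
Lemma sphere_param_surj x : sphere x ->
  exists b, angle_domain b /\ sphere_param b = x.
Proof.
case: x => [[u v] z]; rewrite /sphere /= => uvz.
have z1 : -1 <= z <= 1 by have := sqr_ge0 u; have := sqr_ge0 v; nra.
have [/andP[a0 api] cosa] := acos_def z1.
have sina := sin_acos z1.
set s := Num.sqrt _ in sina.
have s2 : s ^+ 2 = u ^+ 2 + v ^+ 2.
  by rewrite sqr_sqrtr -uvz ?addrK// addr_ge0 ?sqr_ge0.
have pi0 := @pi_gt0 R.
have s0 : 0 <= s by exact: sqrtr_ge0.
have dom (y : R) : 0 <= y -> y < 2 * pi -> angle_domain (acos z, y).
  by move=> y0 ypi; split; rewrite /= in_itv/= ?a0 ?y0.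
have [s_eq0|s_neq0] := eqVneq s 0.
  exists (acos z, 0); split; first by apply: dom; rewrite ?mulr_gt0.
  rewrite /sphere_param /= cosa sina s_eq0 !mul0r.
  have /eqP : u ^+ 2 + v ^+ 2 = 0 by rewrite -s2 s_eq0 expr0n.
  by rewrite paddr_eq0 ?sqr_ge0// !sqrf_eq0 => /andP[/eqP -> /eqP ->].
have s_gt0 : 0 < s by rewrite lt_neqAle eq_sym s_neq0.
have us1 : (u / s) ^+ 2 + (v / s) ^+ 2 = 1.
  by rewrite !expr_div_n -mulrDl -s2 divff ?expf_neq0.
have c1 : -1 <= u / s <= 1 by have := sqr_ge0 (v / s); nra.
have [/andP[t0 tpi] cost] := acos_def c1.
have sint : sin (acos (u / s)) = `|v / s|.
  by rewrite sin_acos// -us1 addrAC subrr add0r sqrtr_sqr.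
have [v0|v0] := leP 0 v.
  exists (acos z, acos (u / s)); split; first by apply: dom => //; lra.
  rewrite /sphere_param /= cosa sina cost sint ger0_norm ?divr_ge0//.
  by rewrite !(mulrC s) !divfK.
exists (acos z, 2 * pi - acos (u / s)); split.
  apply: dom; first by lra.
  (* The azimuth must stay below [2 * pi]: a zero arccosine would give [v = 0], against [v < 0]. *)
  rewrite gtrBl lt_neqAle t0 andbT eq_sym; apply/eqP => t_eq0.
  move: sint; rewrite t_eq0 sin0 => /esym/eqP.
  by rewrite normr_eq0 mulf_eq0 invr_eq0 (lt_eqF v0) (negbTE s_neq0).
have -> : 2 * pi - acos (u / s) = - acos (u / s) + pi *+ 2 by rewrite mulr_natl addrC.
rewrite /sphere_param /= cosD2pi sinD2pi cosN sinN cosa sina cost sint.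
rewrite ltr0_norm ?opprK; last by rewrite pmulr_llt0 ?invr_gt0.
by rewrite !(mulrC s) !divfK.
Qed.

Lemma spherical_coordinatesP x : sphere x ->
  angle_domain (spherical_coordinates x) /\
  sphere_param (spherical_coordinates x) = x.
Proof. by move=> /sphere_param_surj; exact: getPex. Qed.

(* Real and imaginary parts of [(x.1.1 + i x.1.2) ^+ m]. *)
Fixpoint azimuth m x : R * R :=
  if m is m'.+1 then
    (x.1.1 * (azimuth m' x).1 - x.1.2 * (azimuth m' x).2,
     x.1.1 * (azimuth m' x).2 + x.1.2 * (azimuth m' x).1)
  else (1, 0).

Lemma azimuthE m (b : R * R) : azimuth m (sphere_param b) =
  (sin b.1 ^+ m * cos (m%:R * b.2), sin b.1 ^+ m * sin (m%:R * b.2)).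
Proof.
elim: m => [|m ih]; first by rewrite mul0r cos0 sin0 expr0 mulr1 mulr0.
have -> : m.+1%:R * b.2 = b.2 + m%:R * b.2 by rewrite -natr1; ring.
by rewrite [LHS]/= ih /= cosD sinD exprS; congr (_, _); ring.
Qed.

Lemma measurable_azimuth m :
  measurable_fun setT (fun x => (azimuth m x).1) /\
  measurable_fun setT (fun x => (azimuth m x).2).
Proof.
have m1 : measurable_fun setT (fun x : R * R * R => x.1.1) by exact: measurableT_comp.
have m2 : measurable_fun setT (fun x : R * R * R => x.1.2) by exact: measurableT_comp.
elim: m => [|m [ih1 ih2]] /=; first by split; exact: measurable_cst.
by split; [apply: measurable_funB|apply: measurable_funD]; exact: measurable_funM.
Qed.

(* [angle_basis] in Cartesian coordinates: the factor [sin b.1 ^+ m] of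
   [azimuthE] is the [(1 - cos b.1 ^+ 2) `^ (m / 2)] of the associated Legendre
   function, so that nothing is singular at the poles. *)
Definition angle_function p j m x : R :=
  (if m == 0%N then (~~ p)%:R
   else 2 * (if p then - (azimuth m x).2 else (azimuth m x).1)) *
  (Num.sqrt ((2 * j%:R + 1) / (4 * pi) * (((j - m)`!)%:R / ((j + m)`!)%:R)) *
   ((-1) ^+ m * ((legendre j)^`(m)).[x.2])).

(** Coordinates obtained by choice carry no measurability of their own; it is transferred from this
    polynomial expression in the Cartesian coordinates. *)
Lemma angle_functionE p j m x : sphere x ->
  angle_basis p j m (spherical_coordinates x) = angle_function p j m x.
Proof.
move=> /spherical_coordinatesP; set b := spherical_coordinates x => -[domb <-].
have s0 := angle_domain_sin_ge0 domb.
rewrite /angle_basis /angle_function /normalized_legendre /assoc_legendre azimuthE.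
have -> : (1 - cos b.1 ^+ 2) `^ (m%:R / 2) = sin b.1 ^+ m.
  have -> : 1 - cos b.1 ^+ 2 = sin b.1 `^ 2%:R.
    by rewrite powR_mulrn// -[1](cos2Dsin2 b.1) addrAC subrr add0r.
  by rewrite -powRrM [_ * (_ / 2)]mulrC divfK// powR_mulrn.
case: ifP => [/eqP ->|_] /=; first by rewrite !expr0; ring.
by case: p; ring.
Qed.

Lemma measurable_horner (q : {poly R}) : measurable_fun setT (horner q).
Proof.
have -> : horner q = fun y => \sum_(i < size q) q`_i * y ^+ i.
  by apply/funext => y; rewrite horner_coef.
by apply: measurable_sum => i; apply: measurable_funM => //; exact: measurable_funX.
Qed.

Lemma measurable_angle_function p j m : measurable_fun setT (angle_function p j m).
Proof.
have [m1 m2] := measurable_azimuth m.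
apply: measurable_funM; last first.
  do 2 (apply: measurable_funM => //).
  by apply: measurableT_comp; [exact: measurable_horner|exact: measurable_snd].
case: (m == 0%N) => //; apply: measurable_funM => //.
by case: p => //; exact: measurableT_comp.
Qed.

Lemma measurable_sphere : measurable (sphere : set (R * R * R)).
Proof.
have mf : measurable_fun setT
    (fun x : R * R * R => (x.1.1 ^+ 2 + x.1.2 ^+ 2 + x.2 ^+ 2)).
  apply: measurable_funD; first apply: measurable_funD.
  - by apply: measurable_funX; exact: measurableT_comp.
  - by apply: measurable_funX; exact: measurableT_comp.
  - by apply: measurable_funX; exact: measurable_snd.
have := mf measurableT [set 1] (measurable_set1 _); rewrite setTI.
by congr measurable.
Qed.

End sphere_measurability.

(** * Integration over the sphere and the time interval *)

Section space_time_norm.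
Context {R : realType} {d : measure_display} {Omega : measurableType d}.
Variable P : probability Omega R.
Variable T : R.
Hypothesis T_gt0 : 0 < T.

Lemma measurable_space_time :
  measurable (space_time T : set (Omega * (R * R * R) * R)).
Proof.
by apply: measurableX => //; apply: measurableX => //; exact: measurable_sphere.
Qed.

Lemma measurable_time_basis b k : measurable_fun setT (time_basis T b k).
Proof.
rewrite /time_basis; case: (k == 0%N) => //.
have mt : measurable_fun setT (fun t : R => pi * k%:R * t / (2 * T)).
  by apply: measurable_funM => //; exact: measurable_funM.
case: b; apply: measurableT_comp => //; apply: continuous_measurable_fun.
  exact: continuous_cos.
exact: continuous_sin.
Qed.

Lemma measurable_truncated_field_joint
    (A B : nat -> nat -> nat -> nat -> {RV P >-> R}) J K :
  measurable_fun (space_time T)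
    (fun v : Omega * (R * R * R) * R => truncated_field A B T J K v.1.2 v.2 v.1.1).
Proof.
apply/(@measurable_fun_eqP _ _ _ _ _ _ (fun v : Omega * (R * R * R) * R =>
    \sum_(0 <= j < J.+1) \sum_(0 <= k < K.+1) \sum_(0 <= m < j.+1)
      \sum_(p : bool) \sum_(b : bool)
      angle_function p j m v.1.2 * time_basis T b k v.2 *
      coefficient A B (b, (p.+1, j, k, m)) v.1.1)).
  move=> v /[!inE] -[[_ xS] tT]; rewrite truncated_fieldE.
  apply: eq_bigr => j _; apply: eq_bigr => k _; apply: eq_bigr => m _.
  by apply: eq_bigr => p _; apply: eq_bigr => b _; rewrite angle_functionE.
apply: measurable_funTS.
apply: measurable_sum => j; apply: measurable_sum => k; apply: measurable_sum => m.
apply: measurable_sum => p; apply: measurable_sum => b.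
apply: measurable_funM; first apply: measurable_funM.
- apply: measurableT_comp; first exact: measurable_angle_function.
  exact: measurableT_comp.
- by apply: measurableT_comp; [exact: measurable_time_basis|exact: measurable_snd].
- by apply: measurableT_comp => //; exact: measurableT_comp.
Qed.

Let sphere_product_sigma_finite : sigma_finite setT (P \x surface_measure)%E.
Proof.
exists (fun=> setT); first by rewrite bigcup_const//; exists 0%N.
move=> _; split=> //; rewrite -setXTT product_measure1E//.
by rewrite -ge0_fin_numE ?mule_ge0// fin_numM// fin_num_measure.
Qed.

(* The library infers a sigma-finite structure on products of subprobabilities only. *)
Let product_space : {sigma_finite_measure set (Omega * (R * R * R))%type -> \bar R} :=
  HB.pack (P \x surface_measure)%E (Measure_isSigmaFinite.Build _ _ _
    (P \x surface_measure)%E sphere_product_sigma_finite).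

(** Tonelli's theorem, applied twice, makes the integral over [Omega] innermost, where the pointwise
    bound is available. *)
Lemma L2_norm_sqr_le (F : R * R * R -> R -> Omega -> R) (b : R) : 0 <= b ->
  measurable_fun (space_time T) (fun v => F v.1.2 v.2 v.1.1) ->
  (forall x t, sphere x -> t \in `[0, T] ->
    (\int[P]_w (F x t w ^+ 2)%:E <= b%:E)%E) ->
  (L2_norm P T F ^+ 2 <=
   (b * (fine (surface_measure [set: R * R * R]) * T))%:E)%E.
Proof.
move=> b0 mF hF; have mST := measurable_space_time.
pose G : Omega * (R * R * R) * R -> R := (fun v => F v.1.2 v.2 v.1.1) \_ (space_time T).
have mG : measurable_fun setT G by apply/(measurable_restrictT _ mST).
pose g (v : Omega * (R * R * R) * R) : \bar R := (G v ^+ 2)%:E.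
have mg : measurable_fun setT g by apply/measurable_EFinP; exact: measurable_funX.
have g0 v : (0 <= g v)%E by rewrite lee_fin sqr_ge0.
have mgL : measurable_fun [set: Omega * (R * R * R) * measurableTypeR R] g.
  exact: mg.
have -> : L2_norm P T F =
    'N[(P \x surface_measure) \x lebesgue_measure]_2[EFin \o G]%E.
  by rewrite /L2_norm -restrict_EFin.
rewrite Lnorm2_sqr.
have -> : (\int[(P \x surface_measure) \x lebesgue_measure]_v (G v ^+ 2)%:E =
    \int[lebesgue_measure]_t fubini_G (P \x surface_measure) g t)%E.
  exact: (@fubini_tonelli2 _ _ _ (measurableTypeR R) R product_space lebesgue_measure g).
(* The restricted integrand vanishes off [space_time], so [b * I t] is a bound at every [x], on the
   sphere or not. *)
pose I (t : R) := (\1_(`[0, T]) t)%:E : \bar R.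
have I0 t : (0 <= I t)%E by rewrite lee_fin.
have gI x t : (\int[P]_w g (w, x, t) <= b%:E * I t)%E.
  have [[xS tT]|out] := pselect (sphere x /\ t \in `[0, T]).
    apply: (@le_trans _ _ (\int[P]_w (F x t w ^+ 2)%:E)%E).
      rewrite le_eqVlt; apply/orP; left; apply/eqP; apply: eq_integral => w _.
      by rewrite /g /G patchE ifT// inE.
    by rewrite /I indicE mem_set// mule1 hF.
  rewrite integral0_eq ?mule_ge0// => w _.
  rewrite /g /G patchE ifF ?expr0n//; apply/negbTE/negP; rewrite inE => -[[_ ?] ?].
  exact: out.
have gt (t : R) : (fubini_G (P \x surface_measure) g t <=
    b%:E * I t * surface_measure [set: R * R * R])%E.
  have mgt : measurable_fun setT (fun u => g (u, t)) by exact: measurableT_comp.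
  rewrite /fubini_G (fubini_tonelli2 _ mgt (fun=> g0 _)) -integral_cst//.
  apply: ge0_le_integral => //.
  - by move=> x _; apply: integral_ge0.
  - exact: measurable_fun_fubini_tonelli_G.
  - by move=> x _; exact: gI.
apply: (@le_trans _ _ (\int[lebesgue_measure]_t
    (b%:E * I t * surface_measure [set: R * R * R]))%E).
  apply: ge0_le_integral => //.
  - by move=> t _; apply: integral_ge0.
  - exact: (measurable_fun_fubini_tonelli_G (m1 := product_space)).
  - apply: emeasurable_funM => //; apply: emeasurable_funM => //.
    by apply/measurable_EFinP; exact: measurable_indic.
have sfin : (surface_measure [set: R * R * R]) \is a fin_num by exact: fin_num_measure.
under eq_integral do rewrite muleAC -(fineK sfin) -[(b%:E * (fine _)%:E)%E]EFinM.
rewrite ge0_integralZl//; last first.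
- by rewrite lee_fin mulr_ge0// fine_ge0.
- by apply/measurable_EFinP; exact: measurable_indic.
have mT : lebesgue_measure (`[0%R, T]%classic : set R) = T%:E.
  by rewrite lebesgue_measure_itv/= lte_fin T_gt0 oppr0 adde0.
by rewrite integral_indic// setIT [X in (_ * X)%E]mT -EFinM mulrA.
Qed.

End space_time_norm.

Theorem theorem5p1 (R : realType) (d : measure_display)
    (Omega : measurableType d) (P : probability Omega R)
    (T : R) (a : nat -> nat -> R)
    (A B : nat -> nat -> nat -> nat -> {RV P >-> R})
    (Z : R * R * R -> R -> Omega -> R)
    (nu1 nu2 C1 C2 C3 : R) (j0 k0 : nat) :
  measure_is_complete P ->
  0 < T ->
  (forall j k, 0 <= a j k) ->
  summable [set: nat * nat] (fun jk => (a jk.1 jk.2)%:E) ->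
  gaussian_coefficients A B a ->
  is_field A B T Z ->
  2 <= nu1 -> 2 <= nu2 ->
  0 < C1 -> 0 < C2 -> 0 < C3 -> (0 < j0)%N -> (0 < k0)%N ->
  (forall j, (j0 <= j)%N -> a j 0%N <= C1 * j%:R `^ (- nu1)) ->
  (forall k, (k0 <= k)%N -> a 0%N k <= C2 * k%:R `^ (- nu2)) ->
  (forall j k, (0 < j)%N -> (0 < k)%N -> (j0 <= j)%N || (k0 <= k)%N ->
    a j k <= C3 * j%:R `^ (- nu1) * k%:R `^ (- nu2)) ->
  exists Ct1 Ct2 : R, [/\ 0 < Ct1, 0 < Ct2 &
    forall J K : nat, (0 < J)%N -> (0 < K)%N ->
      (L2_norm P T (fun x t w => (Z x t w - truncated_field A B T J K x t w)%R)
         ^+ 2 <=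
       (Ct1 * J%:R `^ (- (nu1 - 2)) +
        Ct2 * J%:R * K%:R `^ (- (nu2 - 1)))%:E)%E].
Proof.
move=> _ T0 a0 _ gaussian field nu1_ge2 nu2_ge2 C1_gt0 C2_gt0 C3_gt0 _ k0_gt0
  aj0 a0k ajk.
have [V V_ub] := energy_bounded a0 gaussian field T0.
pose D1 := degree_constant nu1 nu2 C1 C3 j0 V.
pose D2 := frequency_constant nu2 C2 C3 k0 V.
have D1_gt0 : 0 < D1 by apply: (degree_constant_gt0 (a := a)).
have D2_gt0 : 0 < D2 by apply: (frequency_constant_gt0 (a := a)).
pose c := fine (surface_measure [set: R * R * R]) * T.
have c0 : 0 <= c by apply: mulr_ge0; [exact: fine_ge0|exact: ltW].
have c1 : 0 < c + 1 by rewrite ltr_wpDl.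
(* Adding 1 to [c] keeps both constants positive without computing the area of the sphere. *)
exists (D1 * (c + 1)), (D2 * (c + 1)).
split; [exact: mulr_gt0|exact: mulr_gt0|move=> J K J0 K0].
pose b := D1 * J%:R `^ (- (nu1 - 2)) + D2 * J%:R * K%:R `^ (- (nu2 - 1)).
have b0 : 0 <= b.
  by apply: addr_ge0; do ?apply: mulr_ge0 => //; rewrite ?powR_ge0// ltW.
apply: (@le_trans _ _ (b * c)%:E).
  apply: L2_norm_sqr_le => //.
    apply: measurable_funB; first by case: field.
    exact: measurable_truncated_field_joint.
  move=> x t xS tT; apply: (truncation_error a0 gaussian field xS tT b0) => N M JN KM.
  exact: (truncation_tail a0 nu1_ge2 nu2_ge2 C1_gt0 C2_gt0 C3_gt0 k0_gt0
    aj0 a0k ajk V_ub J0 K0 JN KM).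
rewrite lee_fin [leRHS](_ : _ = b * (c + 1)); last by rewrite /b; ring.
by rewrite ler_wpM2l// lerDl.
Qed.
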